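(* The metric space $(OS_n,\delta_{cb})$ is non-separable if $n>2$.
   Context: An operator space is a closed subspace of $B(H)$ for some Hilbert space $H$. $OS_n$ is the set of all $n$-dimensional operator spaces, where two spaces are identified if they are completely isometric. For $E,F\in OS_n$, $d_{cb}(E,F)=\inf\{\|u\|_{cb}\|u^{-1}\|_{cb}\}$, the infimum over all linear isomorphisms $u\colon E\to F$, where $\|\cdot\|_{cb}$ is the completely bounded norm; $\delta_{cb}(E,F)=\log d_{cb}(E,F)$, which is a (complete) metric on $OS_n$. *)

(* Defs.v *)
From HB Require Import structures.
From mathcomp Require Import all_boot all_order all_algebra.
From mathcomp Require Import complex sesquilinear.
From mathcomp Require Import all_classical all_reals all_analysis.

Set Implicit Arguments.
Unset Strict Implicit.
Unset Printing Implicit Defensive.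

Import Order.TTheory GRing.Theory Num.Theory ComplexField.
Import numFieldNormedType.Exports.

Local Open Scope ring_scope.
Local Open Scope classical_set_scope.
Local Open Scope complex_scope.

Record hilbert (R : realType) := Hilbert {
  hilbert_sort :> completeNormedModType R[i];
  hdot : {dot hilbert_sort for (@Num.conj R[i])};
  hdotxx : forall x, hdot x x = `|x| ^+ 2 }.

(* The norm of a normed module over R[i] takes its values in R[i]; this is the
   same norm with values in R. *)
Definition rnorm (R : realType) (V : normedModType R[i]) (x : V) : R :=
  complex.Re `|x|.

Section operators.
Variables (R : realType) (H : hilbert R).

(* The norm of the Hilbert space sum of m copies of H. *)
Definition l2norm m (h : 'I_m -> H) : R := Num.sqrt (\sum_i rnorm (h i) ^+ 2).

Definition bounded_op : set (H -> H) :=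
  [set T | linear T /\ continuous T].

Definition opnorm (T : H -> H) : \bar R :=
  ereal_sup [set (rnorm (T x))%:E | x in [set x | rnorm x <= 1]].

(* The norm of M_m(B(H)) = B(H^m), for the operator matrix A acting on H^m. *)
Definition mxopnorm m (A : 'M[H -> H]_m) : \bar R :=
  ereal_sup [set (l2norm (fun i => \sum_j A i j (h j)))%:E
            | h in [set h : 'I_m -> H | l2norm h <= 1]].

End operators.

Record opspace (R : realType) := OpSpace {
  os_hilbert : hilbert R;
  os_set : set (os_hilbert -> os_hilbert);
  os_bounded : os_set `<=` @bounded_op R os_hilbert;
  os_submod : submod_closed (mem os_set);
  os_closed : forall T : os_hilbert -> os_hilbert, bounded_op T ->
    (forall e : R, 0 < e ->
       exists2 S, os_set S & (opnorm (T \- S)%R < e%:E)%E) ->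
    os_set T }.

Arguments os_set {R} E : rename.

Section opspace_elements.
Variables (R : realType) (E : opspace R).

Definition os_pred : {pred os_hilbert E -> os_hilbert E} := mem (os_set E).

HB.instance Definition _ := GRing.isSubmodClosed.Build R[i] _ os_pred (os_submod E).

Definition os_sort : Type := {T : os_hilbert E -> os_hilbert E | T \in os_pred}.

HB.instance Definition _ := SubChoice.on os_sort.
HB.instance Definition _ :=
  [SubChoice_isSubLmodule of os_sort by <:].

End opspace_elements.

Coercion os_sort : opspace >-> Sortclass.

Section cb.
Variable R : realType.

Definition mxnorm (E : opspace R) m (x : 'M[E]_m) : \bar R :=
  mxopnorm (map_mx val x).

Section cbnorm.
Variables E F : opspace R.

(* The norm of the amplification M_m(E) -> M_m(F) of u. *)
Definition ampnorm m (u : E -> F) : \bar R :=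
  ereal_sup [set mxnorm (map_mx u x) | x in [set x : 'M[E]_m | mxnorm x <= 1]%E].

Definition cbnorm (u : E -> F) : \bar R := ereal_sup (range (ampnorm ^~ u)).

End cbnorm.

Definition dcb (E F : opspace R) : \bar R :=
  ereal_inf [set r | exists (u : {linear E -> F}) (v : {linear F -> E}),
    [/\ cancel u v, cancel v u & r = cbnorm u * cbnorm v]%E].

Definition completely_isometric (E F : opspace R) : Prop :=
  exists u : {linear E -> F}, bijective u /\
    forall m (x : 'M[E]_m), mxnorm (map_mx u x) = mxnorm x.

Definition has_dim (E : opspace R) n : Prop :=
  exists f : {linear 'rV[R[i]]_n -> E}, bijective f.

End cb.

Section theory.
Variable R : realType.

Section rnorm.
Variable V : normedModType R[i].
Implicit Types x y : V.

Lemma rnormE x : `|x| = (rnorm x)%:C.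
Proof.
have := normr_ge0 x; rewrite /rnorm; case: `|x| => a b.
by rewrite lecE/= => /andP[/eqP -> _].
Qed.

Lemma rnorm_ge0 x : 0 <= rnorm x.
Proof. by have := normr_ge0 x; rewrite rnormE lecE/= => /andP[]. Qed.

Lemma rnorm0 : rnorm (0 : V) = 0.
Proof. by rewrite /rnorm normr0. Qed.

Lemma rnorm_eq0 x : rnorm x = 0 -> x = 0.
Proof. by move=> x0; apply/normr0_eq0; rewrite rnormE x0. Qed.

Lemma rnormD x y : rnorm (x + y) <= rnorm x + rnorm y.
Proof.
by have := ler_normD x y; rewrite !rnormE -rmorphD lecR.
Qed.

Lemma rnormZ (a : R) x : 0 <= a -> rnorm (a%:C *: x) = a * rnorm x.
Proof.
move=> a0; apply: complexI; rewrite rmorphM -!rnormE normrZ.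
by rewrite ger0_norm ?ler0c// rnormE.
Qed.

Lemma rnorm_sum (I : Type) (r : seq I) (F : I -> V) :
  rnorm (\sum_(i <- r) F i) <= \sum_(i <- r) rnorm (F i).
Proof.
elim/big_ind2: _ => //; first by rewrite rnorm0.
by move=> x a y b xa yb; rewrite (le_trans (rnormD _ _)) ?lerD.
Qed.

End rnorm.

Section l2norm.
Variables (H : hilbert R) (m : nat).
Implicit Types h : 'I_m -> H.

Lemma l2norm_ge0 h : 0 <= l2norm h.
Proof. exact: sqrtr_ge0. Qed.

Lemma rnorm_l2norm h i : rnorm (h i) <= l2norm h.
Proof.
rewrite /l2norm -(ger0_norm (rnorm_ge0 (h i))) -sqrtr_sqr ler_wsqrtr//.
by rewrite (bigD1 i)//= lerDl sumr_ge0// => j _; rewrite sqr_ge0.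
Qed.

Lemma l2norm_eq0 h : (forall i, h i = 0) -> l2norm h = 0.
Proof.
by move=> h0; rewrite /l2norm big1 ?sqrtr0// => i _; rewrite h0 rnorm0 expr0n.
Qed.

Lemma l2normZ (a : R) h : 0 <= a ->
  l2norm (fun i => a%:C *: h i) = a * l2norm h.
Proof.
move=> a0; rewrite /l2norm.
under eq_bigr do rewrite rnormZ// exprMn.
by rewrite -mulr_sumr sqrtrM ?sqr_ge0// sqrtr_sqr ger0_norm.
Qed.

Lemma l2norm_le h (c : 'I_m -> R) : (forall i, rnorm (h i) <= c i) ->
  l2norm h <= Num.sqrt (\sum_i c i ^+ 2).
Proof.
move=> hc; rewrite ler_wsqrtr// ler_sum// => i _.
by rewrite ler_sqr ?nnegrE ?rnorm_ge0// (le_trans (rnorm_ge0 _) (hc i)).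
Qed.

End l2norm.

Section mxnorm.
Variables (E : opspace R) (m : nat).
Implicit Types (x : 'M[E]_m).
Let H := os_hilbert E.

Lemma elem_bounded (T : E) : bounded_op (val T).
Proof. by apply: os_bounded; case: T => T/= /set_mem. Qed.

Definition mxapply x (h : 'I_m -> H) (i : 'I_m) : H :=
  \sum_j val (x i j) (h j).

Lemma mxnormE x : mxnorm x =
  ereal_sup [set (l2norm (mxapply x h))%:E | h in [set h | l2norm h <= 1]].
Proof.
congr ereal_sup; apply/seteqP; split=> _ [h h1 <-]; exists h => //;
  congr ((l2norm _)%:E); apply/funext => i; rewrite /mxapply;
  by under eq_bigr do rewrite ?mxE; under [RHS]eq_bigr do rewrite ?mxE.
Qed.

Lemma mxapply_le_mxnorm x h : l2norm h <= 1 ->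
  ((l2norm (mxapply x h))%:E <= mxnorm x)%E.
Proof. by move=> h1; rewrite mxnormE; apply: ereal_sup_ubound; exists h. Qed.

Lemma mxnorm_ge0 x : (0 <= mxnorm x)%E.
Proof.
apply: le_trans (@mxapply_le_mxnorm x (fun=> 0) _); first exact: l2norm_ge0.
by rewrite l2norm_eq0.
Qed.

Lemma val_elem0 (h : H) : val (0 : E) h = 0.
Proof. by rewrite raddf0. Qed.

Lemma mxnorm0 : mxnorm (0 : 'M[E]_m) = 0%E.
Proof.
apply/eqP; rewrite eq_le mxnorm_ge0 andbT mxnormE.
apply: ge_ereal_sup => _ [h _ <-]; rewrite l2norm_eq0// => i.
by rewrite /mxapply big1// => j _; rewrite mxE val_elem0.
Qed.

Lemma mxnorm_fin x : mxnorm x \is a fin_num.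
Proof.
have bd (T : E) : exists k : R, forall h, rnorm h <= 1 ->
    rnorm (val T h) <= k.
  have [lT cT] := elem_bounded T.
  pose f : {linear H -> H} := HB.pack (val T) (GRing.isLinear.Build _ _ _ _ _ lT).
  have /linear_bounded_continuous : continuous f by [].
  rewrite linear_boundedP => /pinfty_ex_gt0[r r0 fr].
  exists (complex.Re r) => h h1; have := fr h; rewrite !rnormE => fh.
  have : (rnorm (f h))%:C <= r.
    by rewrite (le_trans fh)// ler_piMr ?(ltW r0)// lecR.
  by rewrite lecE/= => /andP[].
have /choice[k kP] := bd.
pose c i := \sum_j k (x i j).
rewrite ge0_fin_numE ?mxnorm_ge0// mxnormE.
apply: (@le_lt_trans _ _ (Num.sqrt (\sum_i c i ^+ 2))%:E); last by rewrite ltry.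
apply: ge_ereal_sup => _ [h h1 <-]; rewrite lee_fin; apply: l2norm_le => i.
rewrite (le_trans (rnorm_sum _ _))// ler_sum// => j _.
by rewrite kP// (le_trans (rnorm_l2norm h j)).
Qed.

Lemma mxnormZ_le (a : R) x : 0 <= a ->
  (mxnorm (map_mx ( *:%R a%:C) x) <= a%:E * mxnorm x)%E.
Proof.
move=> a0; rewrite mxnormE; apply: ge_ereal_sup => _ [h h1 <-].
apply: (@le_trans _ _ (a%:E * (l2norm (mxapply x h))%:E)%E); last first.
  by rewrite lee_wpmul2l ?lee_fin// mxapply_le_mxnorm.
rewrite -EFinM -l2normZ// (_ : mxapply _ h = fun i => a%:C *: mxapply x h i)//.
apply/funext => i; rewrite /mxapply scaler_sumr.
by apply: eq_bigr => j _; rewrite mxE.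
Qed.

Lemma mxnorm_eq0 x : mxnorm x = 0%E -> x = 0.
Proof.
move=> x0; apply/matrixP => i j; rewrite mxE; apply: val_inj; apply/funext => h.
rewrite val_elem0; have [lT _] := elem_bounded (x i j).
pose f : {linear H -> H} :=
  HB.pack (val (x i j)) (GRing.isLinear.Build _ _ _ _ _ lT).
rewrite -[LHS]/(f h).
have f1 k : rnorm k <= 1 -> f k = 0.
  move=> k1; pose h' j' := if j' == j then k else 0.
  have h'1 : l2norm h' <= 1.
    rewrite /l2norm (bigD1 j)//= big1 ?addr0; last first.
      by move=> j' /negbTE j'j; rewrite /h' j'j rnorm0 expr0n.
    by rewrite sqrtr_sqr ger0_norm ?rnorm_ge0// /h' eqxx.
  have := mxapply_le_mxnorm x h'1; rewrite x0 lee_fin => xh'.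
  apply: rnorm_eq0; apply/eqP; rewrite eq_le rnorm_ge0 andbT.
  rewrite (le_trans _ xh')// (le_trans _ (rnorm_l2norm _ i))//.
  rewrite /mxapply (bigD1 j)//= big1 ?addr0 /h' ?eqxx// => j' /negbTE ->.
  have [lT' _] := elem_bounded (x i j').
  exact: (linear0 (HB.pack (val (x i j'))
    (GRing.isLinear.Build _ _ _ _ _ lT') : {linear H -> H})).
have [h0|h0] := eqVneq (rnorm h) 0; first by rewrite (rnorm_eq0 h0) linear0.
have : f ((rnorm h)^-1%:C *: h) = 0.
  by apply: f1; rewrite rnormZ ?invr_ge0 ?rnorm_ge0// mulVf.
move=> /(congr1 (fun z => (rnorm h)%:C *: z)).
by rewrite linearZ scalerA -rmorphM mulfV// scale1r scaler0.
Qed.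

End mxnorm.

Section ampnorm.
Variables (E F : opspace R).

Lemma ampnorm_ge0 m (u : E -> F) : (0 <= ampnorm m u)%E.
Proof.
apply: le_trans (mxnorm_ge0 (map_mx u (0 : 'M[E]_m))) _.
by apply: ereal_sup_ubound; exists 0 => //=; rewrite mxnorm0 lee01.
Qed.

Lemma ampnorm_le_cbnorm m (u : E -> F) : (ampnorm m u <= cbnorm u)%E.
Proof. by apply: ereal_sup_ubound; exists m. Qed.

Lemma cbnorm_ge0 (u : E -> F) : (0 <= cbnorm u)%E.
Proof. exact: le_trans (ampnorm_ge0 0 u) (ampnorm_le_cbnorm 0 u). Qed.

Lemma mxnorm_map_le (u : {linear E -> F}) m (x : 'M[E]_m) :
  (mxnorm (map_mx u x) <= cbnorm u * mxnorm x)%E.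
Proof.
have [x0|x0] := eqVneq (mxnorm x) 0%E.
  rewrite (mxnorm_eq0 x0) mxnorm0 mule0 (_ : map_mx u 0 = 0) ?mxnorm0//.
  by apply/matrixP => i j; rewrite !mxE linear0.
pose N := fine (mxnorm x).
have NE : mxnorm x = N%:E by rewrite fineK ?mxnorm_fin.
have N0 : 0 < N.
  by rewrite -lte_fin -NE lt_neqAle eq_sym x0 mxnorm_ge0.
pose y := map_mx ( *:%R N^-1%:C) x.
have y1 : (mxnorm y <= 1)%E.
  rewrite (le_trans (mxnormZ_le _ _)) ?invr_ge0 ?(ltW N0)//.
  by rewrite NE -EFinM mulVf ?gt_eqF.
have -> : map_mx u x = map_mx ( *:%R N%:C) (map_mx u y).
  apply/matrixP => i j; rewrite !mxE linearZ scalerA -rmorphM mulfV ?gt_eqF//.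
  by rewrite scale1r.
rewrite (le_trans (mxnormZ_le _ (ltW N0)))// NE muleC lee_wpmul2r ?lee_fin ?(ltW N0)//.
rewrite (le_trans _ (ampnorm_le_cbnorm m u))//.
by apply: ereal_sup_ubound; exists y.
Qed.

End ampnorm.

Lemma cbnorm_comp (E F G : opspace R) (v : {linear F -> G}) (u : {linear E -> F}) :
  (cbnorm (v \o u) <= cbnorm v * cbnorm u)%E.
Proof.
apply: ge_ereal_sup => _ [m _ <-]; apply: ge_ereal_sup => _ [x x1 <-].
rewrite map_mx_comp (le_trans (mxnorm_map_le _ _))// lee_wpmul2l ?cbnorm_ge0//.
rewrite (le_trans _ (ampnorm_le_cbnorm m u))//.
by apply: ereal_sup_ubound; exists x.
Qed.

Lemma cbnorm_isometry (E F : opspace R) (u : E -> F) :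
  (forall m (x : 'M[E]_m), mxnorm (map_mx u x) = mxnorm x) -> (cbnorm u <= 1)%E.
Proof.
move=> uE; apply: ge_ereal_sup => _ [m _ <-].
by apply: ge_ereal_sup => _ [x x1 <-]; rewrite uE.
Qed.

Lemma completely_isometric_refl (E : opspace R) : completely_isometric E E.
Proof.
exists idfun; split; first by exists idfun.
by move=> m x; rewrite map_mx_id.
Qed.

Lemma bijective_linear_inv (E F : opspace R) (u : {linear E -> F}) :
  bijective u -> exists v : {linear F -> E}, cancel u v /\ cancel v u.
Proof.
move=> [v uv vu].
pose v' : {linear F -> E} :=
  HB.pack v (GRing.isLinear.Build _ _ _ _ _ (can2_linear uv vu)).
by exists v'.
Qed.

Lemma completely_isometric_sym (E F : opspace R) :
  completely_isometric E F -> completely_isometric F E.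
Proof.
move=> [u [/bijective_linear_inv[v [uv vu]] uE]]; exists v; split.
  by exists u.
by move=> m x; rewrite -uE -map_mx_comp map_mx_id.
Qed.

Lemma completely_isometric_trans (E F G : opspace R) : completely_isometric E F ->
  completely_isometric F G -> completely_isometric E G.
Proof.
move=> [u [bu uE]] [v [bv vE]]; exists (v \o u); split; first exact: bij_comp.
by move=> m x; rewrite map_mx_comp vE uE.
Qed.

Lemma dcb_ge0 (E F : opspace R) : (0 <= dcb E F)%E.
Proof.
apply: le_ereal_inf_tmp => _ [u [v [_ _ ->]]].
by rewrite mule_ge0 ?cbnorm_ge0.
Qed.

Lemma dcb_sym (E F : opspace R) : dcb E F = dcb F E.
Proof.
congr ereal_inf; apply/seteqP; split=> _ [u [v [uv vu ->]]];
  by exists v, u; split => //; rewrite muleC.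
Qed.

Lemma dcb_isometric (E F : opspace R) :
  completely_isometric E F -> (dcb E F <= 1)%E.
Proof.
move=> [u [/bijective_linear_inv[v [uv vu]] uE]].
have vE m (x : 'M[F]_m) : mxnorm (map_mx v x) = mxnorm x.
  by rewrite -uE -map_mx_comp (_ : u \o v = id) ?map_mx_id//; exact/funext.
apply: (@le_trans _ _ (cbnorm u * cbnorm v)%E).
  by apply: ereal_inf_lbound; exists u, v.
by rewrite -[leRHS]mule1 lee_pmul ?cbnorm_ge0 ?cbnorm_isometry.
Qed.

Lemma dcb_le_isometric (E F E' F' : opspace R) : completely_isometric E E' ->
  completely_isometric F F' -> (dcb E F <= dcb E' F')%E.
Proof.
have inv (A B : opspace R) : completely_isometric A B ->
    exists (u : {linear A -> B}) (v : {linear B -> A}),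
      [/\ cancel u v, cancel v u, cbnorm u <= 1 & cbnorm v <= 1]%E.
  move=> [u [/bijective_linear_inv[v [uv vu]] uE]]; exists u, v; split => //.
    exact: cbnorm_isometry.
  apply: cbnorm_isometry => m x.
  by rewrite -uE -map_mx_comp (_ : u \o v = id) ?map_mx_id//; exact/funext.
move=> /inv[u [u' [uu' u'u u1 u'1]]] /inv[w [w' [ww' w'w w1 w'1]]].
have cb (A B C D : opspace R) (f : {linear A -> B}) (g : {linear B -> C})
    (h : {linear C -> D}) : (cbnorm f <= 1 -> cbnorm h <= 1 ->
    cbnorm (h \o (g \o f)) <= cbnorm g)%E.
  move=> f1 h1; rewrite (le_trans (cbnorm_comp _ _))//.
  rewrite -[leRHS]mul1e lee_pmul ?cbnorm_ge0// (le_trans (cbnorm_comp _ _))//.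
  by rewrite -[leRHS]mule1 lee_pmul ?cbnorm_ge0.
apply: le_ereal_inf_tmp => _ [p [q [pq qp ->]]].
apply: (@le_trans _ _ (cbnorm (w' \o (p \o u)) * cbnorm (u' \o (q \o w)))%E).
  apply: ereal_inf_lbound; exists (w' \o (p \o u)), (u' \o (q \o w)).
  by split => // x /=; rewrite ?w'w ?pq ?uu' ?u'u ?qp ?ww'.
apply: lee_pmul; [exact: cbnorm_ge0|exact: cbnorm_ge0|exact: (cb _ _ _ _ u p w')|].
exact: (cb _ _ _ _ w q u').
Qed.

Lemma dcb_comp_lt (E F G : opspace R) (a b : R) :
  (dcb E F < a%:E -> dcb F G < b%:E -> dcb E G < (a * b)%:E)%E.
Proof.
move=> /ereal_inf_lt[_ [u1 [v1 [uv1 vu1 ->]]] ra].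
move=> /ereal_inf_lt[_ [u2 [v2 [uv2 vu2 ->]]] rb].
apply: (@le_lt_trans _ _ (cbnorm (u2 \o u1) * cbnorm (v1 \o v2))%E).
  apply: ereal_inf_lbound; exists (u2 \o u1), (v1 \o v2); split => //.
    exact: can_comp.
  exact: can_comp.
apply: (@le_lt_trans _ _ ((cbnorm u2 * cbnorm u1) * (cbnorm v1 * cbnorm v2))%E).
  by rewrite lee_pmul ?cbnorm_ge0 ?cbnorm_comp.
rewrite (muleC (cbnorm u2)) muleACA.
have := mule_ge0 (cbnorm_ge0 u1) (cbnorm_ge0 v1).
have := mule_ge0 (cbnorm_ge0 u2) (cbnorm_ge0 v2).
move: ra rb.
case: (cbnorm u1 * cbnorm v1)%E => [r| |]//; case: (cbnorm u2 * cbnorm v2)%E => [s| |]//.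
by rewrite -EFinM !lte_fin !lee_fin => ra sb s0 r0; rewrite ltr_pM.
Qed.

End theory.

Record opspace_dim (R : realType) n := OpSpaceDim {
  osd_val :> opspace R;
  osd_dim : has_dim osd_val n }.

Section OS.
Variables (R : realType) (n : nat).

(* A family of matrix norms on C^n. *)
Definition matnorm := forall m, 'M['rV[R[i]]_n]_m -> \bar R.

Definition os_class (E : opspace R) : set matnorm :=
  [set N | exists f : {linear 'rV[R[i]]_n -> E},
    bijective f /\ N = fun m x => mxnorm (map_mx f x)].

Lemma os_class_sub (E F : opspace R) :
  completely_isometric E F -> os_class E `<=` os_class F.
Proof.
move=> [u [bu uE]] _ [f [bf ->]]; exists (u \o f); split; first exact: bij_comp.
apply: functional_extensionality_dep => m; apply/funext => x /=.
by rewrite -[RHS]/(mxnorm (map_mx (u \o f) x)) (map_mx_comp f u) uE.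
Qed.

Lemma os_classP (E F : opspace_dim R n) :
  os_class E = os_class F <-> completely_isometric E F.
Proof.
split=> [EF|EF]; last first.
  apply/seteqP; split; apply: os_class_sub => //.
  exact: completely_isometric_sym.
have [f bf] := osd_dim E.
have : os_class F (fun m x => mxnorm (map_mx f x)) by rewrite -EF; exists f.
move=> [g [bg fg]].
have [f' ff' f'f] := bf.
pose f'l : {linear E -> 'rV[R[i]]_n} :=
  HB.pack f' (GRing.isLinear.Build _ _ _ _ _ (can2_linear ff' f'f)).
exists (g \o f'l); split; first by apply: bij_comp => //; exists f.
move=> m x; rewrite -[LHS]/(mxnorm (map_mx (g \o f') x)) (map_mx_comp f' g).
have /= <- := congr1 (fun N : matnorm => N m (map_mx f' x)) fg; congr mxnorm.
by apply/matrixP => i j; rewrite !mxE f'f.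
Qed.

(* The quotient of opspace_dim R n by complete isometry. Since opspace_dim
   quantifies over all Hilbert spaces, it lives in too large a universe to be a
   choiceType and {eq_quot _} does not apply; a class is represented instead by
   the set of all matrix norms on C^n induced by the linear isomorphisms from
   C^n onto a member of the class. os_of is the quotient map, see os_ofP. *)
Definition OS : Type :=
  {c : set matnorm | `[< exists E : opspace_dim R n, os_class E = c >]}.

HB.instance Definition _ := Choice.on OS.

Definition os_of (E : opspace_dim R n) : OS :=
  exist _ (os_class E) (asboolT (ex_intro _ E erefl)).

Definition os_repr (x : OS) : opspace_dim R n := projT1 (cid (asboolW (valP x))).

Lemma os_reprK : cancel os_repr os_of.
Proof.
by move=> x; apply: val_inj; rewrite /os_repr/=; case: cid.
Qed.

Lemma os_ofP (E F : opspace_dim R n) :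
  os_of E = os_of F <-> completely_isometric E F.
Proof.
rewrite -os_classP; split=> [/(congr1 val)//|EF]; exact: val_inj.
Qed.

(* Independent of the representatives, see delta_cb_of. *)
Definition delta_cb (x y : OS) : \bar R := lne (dcb (os_repr x) (os_repr y)).

Lemma delta_cb_of (E F : opspace_dim R n) :
  delta_cb (os_of E) (os_of F) = lne (dcb E F).
Proof.
have rE (A : opspace_dim R n) : completely_isometric (os_repr (os_of A)) A.
  by apply/os_ofP; rewrite os_reprK.
congr lne; apply/eqP; rewrite eq_le.
by rewrite !dcb_le_isometric//; exact/completely_isometric_sym.
Qed.

Lemma delta_cb_ltE x y (e : R) : (delta_cb x y < e%:E)%E =
  (dcb (os_repr x) (os_repr y) < (expR e)%:E)%E.
Proof.
by rewrite -lte_expeR lneK// in_itv/= dcb_ge0 leey.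
Qed.

Let dball (x : OS) (e : R) : set OS := [set y | (delta_cb x y < e%:E)%E].

Let dball_center x (e : R) : 0 < e -> dball x e x.
Proof.
move=> e0; rewrite /dball/= delta_cb_ltE.
rewrite (le_lt_trans (dcb_isometric (completely_isometric_refl _)))//.
by rewrite lte_fin expR_gt1.
Qed.

Let dball_sym x y (e : R) : dball x e y -> dball y e x.
Proof. by rewrite /dball/= !delta_cb_ltE dcb_sym. Qed.

Let dball_triangle x y z e1 e2 : dball x e1 y -> dball y e2 z ->
  dball x (e1 + e2) z.
Proof.
by rewrite /dball/= !delta_cb_ltE expRD; exact: dcb_comp_lt.
Qed.

HB.instance Definition _ := hasNbhs.Build OS (nbhs_ (entourage_ dball)).

HB.instance Definition _ := @Nbhs_isPseudoMetric.Build R OS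
  (entourage_ dball) erefl dball dball_center dball_sym dball_triangle erefl.

Lemma ballE_delta_cb (x : OS) e :
  ball x e = [set y | (delta_cb x y < e%:E)%E].
Proof. by []. Qed.

Lemma dense_delta_cb (D : set OS) : dense D <->
  forall (x : OS) (e : R), 0 < e -> exists2 y, D y & (delta_cb x y < e%:E)%E.
Proof.
split=> [dD x e e0|dD O [x Ox] oO].
  have [|y [xy Dy]] := dD (ball x e)^° _ (open_interior _).
    by exists x; exact: nbhsx_ballx.
  by exists y => //; exact: interior_subset xy.
have /nbhs_ballP[e /= e0 xeO] := open_nbhs_nbhs (conj oO Ox).
by have [y Dy xy] := dD x e e0; exists y; split => //; exact: xeO.
Qed.

End OS.

Definition separable_space (T : topologicalType) : Prop :=
  exists2 D : set T, countable D & dense D.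

(* Main.v *)
Require Import Defs.
From HB Require Import structures.
From mathcomp Require Import all_boot all_order all_algebra.
From mathcomp Require Import complex sesquilinear zify ring lra.
From mathcomp Require Import all_classical all_reals all_analysis.

(** The metric space of n-dimensional operator spaces contains, for n > 2, a
family [os_blocks W] indexed by all the sets W of natural numbers, which cannot
be approximated by countably many spaces.

The spaces. Let X_N be the set of the points of order exactly N+2 of the torus
(R/Z)^2, and let three operators act on l2(X_N): U_0 = 1, U_1 = the shear
(a, b) -> (a + b, b) followed by multiplication by the character exp(2 i pi a),
and U_2 = the shear (a, b) -> (a, b - a). [os_blocks W] is spanned by the direct
sums of the U_i over the N in W, with U_i = 0 for i > 2, to which one adds a
diagonal n x n block: it reads off the coordinates, so it makes the n generators
linearly independent and their span closed.

The test matrices. [test N] is the sum over i of conj(U_i on X_N) (x) e_i, with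
coefficients in the n-dimensional space. Its norm in [os_blocks W] is the
supremum over M in W of the norms of T = sum_i conj(U_i on X_N) (x) (U_i on X_M),
to which the diagonal block adds only a norm at most 1.
If M = N this norm is 3, reached at the invariant vector sum_k e_k (x) e_k
([mxnorm_test_ge]). If M <> N the operator T acts on the functions of the pairs
(k, l) through the point t = l - k, which is never 0, and its norm is at
most sqrt(9 - 1/188) < 3 ([block_bound], [mxnorm_test_le]). Here three operators
are needed: 1 and two others which generate a rich enough group, whence n > 2.

The spectral gap ([spectral_gap]) is the relative property (T) of the pair
formed by Z^2 and its semidirect product with SL_2(Z). Suppose f is almost
invariant under g_1 = U_1 and g_2 = U_2. The shears satisfy the braid relation,
so g_1 g_2 g_1 and g_2 g_1 g_2 differ by multiplication by a character of t: the
mass of f sits where this character is close to 1, and, after conjugation by the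
shears, near t = 0 ([gap_far]). There the shears act as linear maps of the
plane. On the union of the two quadrants where both coordinates have the same
sign, the shears L and U^-1 have disjoint images contained in that union, each
of which carries almost the mass of the whole ([gap_sector]); so this mass is
small. The two other quadrants are treated with L^-1 and U ([gap_sector']), and
since t <> 0 nothing else is left.

Non-separability. If countably many spaces were dense, each [os_blocks W] would
be close to one of them, F, through an isomorphism which is described by a complex
n x n matrix once a basis of F is fixed. Rounding this matrix leaves countably
many possibilities, and a small change of the matrix changes little the norms of
the test matrices, whatever their size ([mxnorm_monomial_perturb]). Two sets with
the same F and the same rounded matrix therefore give norms which are almost the
same to every test matrix, hence are equal ([encodes_sub]), and there would be an
injection of the sets of natural numbers into a countable type. *)

Set Implicit Arguments.
Unset Strict Implicit.
Unset Printing Implicit Defensive.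
Import Order.TTheory GRing.Theory Num.Theory ComplexField.
Import numFieldNormedType.Exports.
Local Open Scope ring_scope.
Local Open Scope classical_set_scope.
Local Open Scope complex_scope.

(** * Squared moduli of complex numbers and sums of squares *)

Section sqmod.
Variable R : realType.
Implicit Types z w : R[i].

Definition sqmod z : R := complex.Re z ^+ 2 + complex.Im z ^+ 2.

Lemma sqmod_ge0 z : 0 <= sqmod z.
Proof. by rewrite addr_ge0 ?sqr_ge0. Qed.

Lemma sqmod0 : sqmod 0 = 0.
Proof. by rewrite /sqmod/= expr0n addr0. Qed.

Lemma sqmod1 : sqmod 1 = 1.
Proof. by rewrite /sqmod/= expr0n expr1n addr0. Qed.

Lemma sqmodM z w : sqmod (z * w) = sqmod z * sqmod w.
Proof. by case: z w => [a b] [c d]; rewrite /sqmod/=; ring. Qed.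

Lemma sqmodN z : sqmod (- z) = sqmod z.
Proof. by case: z => [a b]; rewrite /sqmod/= !sqrrN. Qed.

Lemma sqmod_conj z : sqmod z^* = sqmod z.
Proof. by case: z => [a b]; rewrite /sqmod/= sqrrN. Qed.

Lemma sqmod_eq0 z : sqmod z = 0 -> z = 0.
Proof.
case: z => [a b]; rewrite /sqmod/= => /eqP.
by rewrite paddr_eq0 ?sqr_ge0// !sqrf_eq0 => /andP[/eqP -> /eqP ->].
Qed.

Lemma normc_sqmod z : `|z| = (Num.sqrt (sqmod z))%:C.
Proof. by rewrite normc_def. Qed.

Lemma sqmodD_le (t : R) z w : 0 < t ->
  sqmod (z + w) <= (1 + t) * sqmod z + (1 + t^-1) * sqmod w.
Proof.
case: z w => [a b] [c d] t0; rewrite /sqmod/=.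
have sq (x y : R) : (x + y) ^+ 2 <= (1 + t) * x ^+ 2 + (1 + t^-1) * y ^+ 2.
  rewrite -subr_ge0 (_ : _ - _ = t^-1 * (t * x - y) ^+ 2).
    by rewrite mulr_ge0 ?sqr_ge0// invr_ge0 ltW.
  by field; rewrite gt_eqF.
have := sq a c; have := sq b d; lra.
Qed.

Lemma sqmodD2 (z w : R[i]) : sqmod (z + w) <= 2 * (sqmod z + sqmod w).
Proof. by have := sqmodD_le z w (@ltr01 R); rewrite invr1; lra. Qed.

Lemma sqmodD_half (z w : R[i]) : sqmod (z + w) <= 3 / 2 * sqmod z + 3 * sqmod w.
Proof.
have h : 0 < 1 / 2 :> R by lra.
have := sqmodD_le z w h; rewrite invf_div divr1; lra.
Qed.

Lemma sqmodD3 (x y z : R[i]) : sqmod (x + y + z) <= 3 * (sqmod x + sqmod y + sqmod z).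
Proof.
case: x y z => [a b] [c d] [p q]; rewrite /sqmod/=.
have H (x y z : R) : (x + y + z) ^+ 2 <= 3 * (x ^+ 2 + y ^+ 2 + z ^+ 2).
  have := sqr_ge0 (x - y); have := sqr_ge0 (y - z); have := sqr_ge0 (x - z).
  rewrite !sqrrB; lra.
have := H a c p; have := H b d q; lra.
Qed.

End sqmod.

(** Minkowski's inequality from a family of quadratic ones: (a + b)^2 is the
infimum over t of the right-hand side, reached at t = b / a if a, b > 0. The
right-hand side is linear in the squares, so it passes termwise to sums, finite or
not. *)
Lemma sqrt_le_add (R : realType) (s a b : R) : 0 <= a -> 0 <= b ->
  (forall t, 0 < t -> s <= (1 + t) * a ^+ 2 + (1 + t^-1) * b ^+ 2) ->
  Num.sqrt s <= a + b.
Proof.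
move=> a0 b0 H; rewrite -(ger0_norm (addr_ge0 a0 b0)) -sqrtr_sqr ler_wsqrtr//.
have [a1|a1] := eqVneq a 0.
  apply/ler_addgt0Pl => e e0; have b1 : 0 < b ^+ 2 + 1 by rewrite ltr_wpDl ?sqr_ge0.
  have t0 : 0 < (b ^+ 2 + 1) / e by rewrite divr_gt0.
  have := H _ t0; rewrite a1 expr0n/= mulr0 !add0r => /le_trans; apply.
  rewrite invf_div mulrDl mul1r addrC lerD2r mulrAC ler_pdivrMr// ler_pM2l//.
  by rewrite lerDl.
have [b1|b1] := eqVneq b 0.
  apply/ler_addgt0Pl => e e0; have a2 : 0 < a ^+ 2 + 1 by rewrite ltr_wpDl ?sqr_ge0.
  have t0 : 0 < e / (a ^+ 2 + 1) by rewrite divr_gt0.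
  have := H _ t0; rewrite b1 expr0n/= mulr0 !addr0 => /le_trans; apply.
  rewrite mulrDl mul1r addrC lerD2r mulrAC ler_pdivrMr// ler_pM2l//.
  by rewrite lerDl.
have a2 : 0 < a by rewrite lt_def a1.
have b2 : 0 < b by rewrite lt_def b1.
have := H _ (divr_gt0 b2 a2); rewrite (_ : _ + _ = (a + b) ^+ 2)//.
by field; rewrite a1 b1.
Qed.

(** * The Hilbert space l2(I) *)
Section l2.
Variables (R : realType) (I : choiceType).
Implicit Types f g : I -> R[i].

Definition sqsum f : \bar R := \esum_(i in setT) (sqmod (f i))%:E.

Lemma sqsum_ge0 f : (0 <= sqsum f)%E.
Proof. by apply: esum_ge0 => i _; rewrite lee_fin sqmod_ge0. Qed.

Definition l2_pred : {pred I -> R[i]} := fun f => (sqsum f < +oo)%E.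

Lemma esumZ_le (a : R) (u : I -> R) : 0 <= a -> (forall i, 0 <= u i) ->
  (\esum_(i in setT) (a * u i)%:E <= a%:E * \esum_(i in setT) (u i)%:E)%E.
Proof.
move=> a0 u0; apply: ge_ereal_sup => _ [X [finX _] <-].
under eq_fsbigr do rewrite EFinM.
rewrite -ge0_mule_fsumr; last by move=> i; rewrite lee_fin.
by rewrite lee_wpmul2l ?lee_fin//; apply: ereal_sup_ubound; exists X.
Qed.

Lemma esumZ (a : R) (u : I -> R) : 0 <= a -> (forall i, 0 <= u i) ->
  (\esum_(i in setT) (a * u i)%:E = a%:E * \esum_(i in setT) (u i)%:E)%E.
Proof.
move=> a0 u0; have [->|an0] := eqVneq a 0.
  by rewrite mul0e esum1// => i _; rewrite mul0r.
apply/eqP; rewrite eq_le esumZ_le//=.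
have a1 : 0 < a by rewrite lt_def an0.
rewrite -lee_pdivlMl//.
have := @esumZ_le a^-1 (fun i => a * u i).
rewrite invr_ge0 => /(_ a0 (fun i => mulr_ge0 a0 (u0 i))); apply: le_trans.
by apply: le_esum => i _; rewrite mulrA mulVf// mul1r.
Qed.

Lemma l2_predD f g : f \in l2_pred -> g \in l2_pred -> f + g \in l2_pred.
Proof.
rewrite !unfold_in => fl gl.
apply: (@le_lt_trans _ _ (2%:E * sqsum f + 2%:E * sqsum g)%E); last first.
  by rewrite lte_add_pinfty// lte_mul_pinfty ?sqsum_ge0 ?lee_fin.
rewrite -!esumZ; do ?[by []|by move=> i; exact: sqmod_ge0].
rewrite -esumD; do ?[by move=> i _; rewrite lee_fin mulr_ge0 ?sqmod_ge0].
apply: le_esum => i _; rewrite -EFinD lee_fin.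
by have := sqmodD_le (f i) (g i) (@ltr01 R); rewrite invr1.
Qed.

Lemma l2_predZ (a : R[i]) f : f \in l2_pred -> a *: f \in l2_pred.
Proof.
rewrite !unfold_in => fl; rewrite /sqsum.
under eq_esum do rewrite sqmodM.
rewrite esumZ ?sqmod_ge0//; last by move=> i; exact: sqmod_ge0.
by rewrite lte_mul_pinfty ?lee_fin ?sqmod_ge0.
Qed.

Lemma l2_submod : submod_closed l2_pred.
Proof.
split=> [|a f g fl gl].
  by rewrite unfold_in /sqsum esum1// => i _; rewrite sqmod0.
by rewrite l2_predD// l2_predZ.
Qed.

HB.instance Definition _ :=
  GRing.isSubmodClosed.Build R[i] (I -> R[i]) l2_pred l2_submod.

Definition l2 : Type := {f : I -> R[i] | f \in l2_pred}.
HB.instance Definition _ := SubChoice.on l2.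
HB.instance Definition _ := [SubChoice_isSubLmodule of l2 by <:].

End l2.

Section l2_norm.
Variables (R : realType) (I : choiceType).
Local Notation l2 := (@l2 R I).
Implicit Types f g : l2.

Lemma l2_valD f g i : val (f + g) i = val f i + val g i.
Proof. by []. Qed.

Lemma l2_valZ (a : R[i]) f i : val (a *: f) i = a * val f i.
Proof. by []. Qed.

Definition norm2 f : R := fine (sqsum (val f)).

Lemma norm2E f : sqsum (val f) = (norm2 f)%:E.
Proof.
rewrite /norm2 fineK// ge0_fin_numE ?sqsum_ge0//.
by have := valP f; rewrite unfold_in.
Qed.

Lemma norm2_ge0 f : 0 <= norm2 f.
Proof. by rewrite fine_ge0 ?sqsum_ge0. Qed.

(** Every inequality and identity between squared norms in l2 follows from the
same statement on coordinates; the weights may have any sign, so the sum is split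
into its positive and negative parts before it is summed over [I]. *)
Lemma norm2_comb (s : seq (R * l2)) :
  (forall i, 0 <= \sum_(k <- s) k.1 * sqmod (val k.2 i)) ->
  0 <= \sum_(k <- s) k.1 * norm2 k.2.
Proof.
move=> s0.
have wsum (w : R -> R) : (forall x, 0 <= w x) ->
    (\esum_(i in setT) \sum_(k <- s) (w k.1 * sqmod (val k.2 i))%:E =
     (\sum_(k <- s) w k.1 * norm2 k.2)%:E)%E.
  move=> w0; rewrite (@esum_sum _ _ _ _ s xpredT); last first.
    by move=> i k _ _; rewrite lee_fin mulr_ge0 ?sqmod_ge0.
  rewrite -sumEFin; apply: eq_bigr => k _.
  by rewrite esumZ// ?EFinM -?norm2E// => i; exact: sqmod_ge0.
have split_sum (u : R * l2 -> R) : \sum_(k <- s) k.1 * u k =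
    \sum_(k <- s) Num.max k.1 0 * u k - \sum_(k <- s) Num.max (- k.1) 0 * u k.
  rewrite -sumrB; apply: eq_bigr => k _; rewrite -mulrBl; congr (_ * _).
  by case: (leP k.1 0) => k0; case: (leP (- k.1) 0) => k1; lra.
have w0 (w : R) : 0 <= Num.max w 0 by rewrite le_max lexx orbT.
rewrite split_sum subr_ge0 -lee_fin.
rewrite -(wsum (fun x => Num.max x 0))// -(wsum (fun x => Num.max (- x) 0))//.
apply: le_esum => i _; rewrite !sumEFin lee_fin -subr_ge0 -split_sum.
exact: s0.
Qed.

Lemma norm2_eq (s : seq (R * l2)) :
  (forall i, \sum_(k <- s) k.1 * sqmod (val k.2 i) = 0) ->
  \sum_(k <- s) k.1 * norm2 k.2 = 0.
Proof.
move=> s0; apply/eqP; rewrite eq_le; apply/andP; split; last first.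
  by apply: norm2_comb => i; rewrite s0.
rewrite -oppr_ge0.
have E (u : l2 -> R) : - (\sum_(k <- s) k.1 * u k.2) =
    \sum_(k <- [seq (- k.1, k.2) | k <- s]) k.1 * u k.2.
  by rewrite big_map -sumrN; apply: eq_bigr => k _; rewrite mulNr.
rewrite E; apply: norm2_comb => i.
by rewrite -(E (fun f => sqmod (val f i))) s0 oppr0.
Qed.

Lemma sqmod_le_norm2 f i : sqmod (val f i) <= norm2 f.
Proof.
rewrite -lee_fin -norm2E; apply: esum_ge; exists [set i] => //.
by rewrite fsbig_set1.
Qed.

Lemma norm2Z (a : R[i]) f : norm2 (a *: f) = sqmod a * norm2 f.
Proof.
have := @norm2_eq [:: (1, a *: f); (- sqmod a, f)].
rewrite !big_cons big_nil /= => H.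
have : 1 * norm2 (a *: f) + (- sqmod a * norm2 f + 0) = 0.
  by apply: H => j; rewrite !big_cons big_nil /= sqmodM; ring.
lra.
Qed.

Lemma norm2D_le (t : R) f g : 0 < t ->
  norm2 (f + g) <= (1 + t) * norm2 f + (1 + t^-1) * norm2 g.
Proof.
move=> t0; have := @norm2_comb [:: (- 1, f + g); (1 + t, f); (1 + t^-1, g)].
rewrite !big_cons big_nil /= => H.
suff : 0 <= -1 * norm2 (f + g) + ((1 + t) * norm2 f + ((1 + t^-1) * norm2 g + 0)).
  by lra.
apply: H => j; rewrite !big_cons big_nil /=.
by have := sqmodD_le (val f j) (val g j) t0; lra.
Qed.

Definition l2_norm f : R[i] := (Num.sqrt (norm2 f))%:C.

Lemma l2_normD f g : l2_norm (f + g) <= l2_norm f + l2_norm g.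
Proof.
rewrite /l2_norm -rmorphD lecR; apply: sqrt_le_add; rewrite ?sqrtr_ge0// => t t0.
by rewrite !sqr_sqrtr ?norm2_ge0// norm2D_le.
Qed.

Lemma l2_normZ (a : R[i]) f : l2_norm (a *: f) = `|a| * l2_norm f.
Proof. by rewrite /l2_norm norm2Z sqrtrM ?sqmod_ge0// rmorphM normc_sqmod. Qed.

Lemma l2_norm_eq0 f : l2_norm f = 0 -> f = 0.
Proof.
move=> /(congr1 (@complex.Re R))/= /eqP; rewrite sqrtr_eq0 => f0.
apply/val_inj/funext => i; apply: sqmod_eq0; apply/eqP.
by rewrite eq_le sqmod_ge0 (le_trans (sqmod_le_norm2 f i)).
Qed.

HB.instance Definition _ := Lmodule_isNormed.Build R[i] l2
  l2_normD l2_normZ l2_norm_eq0.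

Lemma l2_normE f : `|f| = (Num.sqrt (norm2 f))%:C.
Proof. by []. Qed.

Lemma l2_rnorm f : rnorm f = Num.sqrt (norm2 f).
Proof. by rewrite /rnorm l2_normE. Qed.

Lemma l2_rnorm_sq f : rnorm f ^+ 2 = norm2 f.
Proof. by rewrite l2_rnorm sqr_sqrtr ?norm2_ge0. Qed.

Lemma norm2_le_fin f (c : R) :
  (forall A : set I, finite_set A -> \sum_(i \in A) sqmod (val f i) <= c) ->
  norm2 f <= c.
Proof.
move=> H; rewrite -lee_fin -norm2E; apply: ge_ereal_sup => _ [A [finA _] <-].
by rewrite fsbig_finite//= sumEFin -fsbig_finite// lee_fin H.
Qed.

Lemma fin_le_norm2 f (A : set I) : finite_set A ->
  \sum_(i \in A) sqmod (val f i) <= norm2 f.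
Proof.
move=> finA; rewrite -lee_fin -norm2E; apply: esum_ge; exists A => //.
by rewrite [leRHS]fsbig_finite//= sumEFin -fsbig_finite.
Qed.

End l2_norm.

Section l2_dot.
Variables (R : realType) (I : choiceType).
Local Notation l2 := (@l2 R I).
Implicit Types f g : l2.

(** Polarization: the scalar product is a combination of squared norms, so that its
bilinearity is an instance of [norm2_eq]. *)
Definition dot_re f g : R := (norm2 (f + g) - norm2 f - norm2 g) / 2.

Definition pdot_re (z w : R[i]) : R := (sqmod (z + w) - sqmod z - sqmod w) / 2.

Lemma dot_re_eq (s : seq (R * (l2 * l2))) :
  (forall i, \sum_(k <- s) k.1 * pdot_re (val k.2.1 i) (val k.2.2 i) = 0) ->
  \sum_(k <- s) k.1 * dot_re k.2.1 k.2.2 = 0.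
Proof.
pose s' := flatten [seq [:: (k.1 / 2, k.2.1 + k.2.2); (- (k.1 / 2), k.2.1);
                            (- (k.1 / 2), k.2.2)] | k <- s].
have E (u : l2 -> R) : \sum_(k <- s') k.1 * u k.2 =
    \sum_(k <- s) k.1 * ((u (k.2.1 + k.2.2) - u k.2.1 - u k.2.2) / 2).
  rewrite /s' big_flatten big_map; apply: eq_bigr => k _.
  by rewrite !big_cons big_nil /=; ring.
move=> s0; rewrite -(E (@norm2 R I)); apply: norm2_eq => i.
by rewrite (E (fun f => sqmod (val f i))) -[RHS](s0 i).
Qed.

Definition l2_dot f g : R[i] := dot_re f g +i* dot_re f ('i *: g).

Lemma l2_dotDl g (a : R[i]) f f' :
  l2_dot (a *: f + f') g = a * l2_dot f g + l2_dot f' g.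
Proof.
case: a => a b; apply/eqP; rewrite eq_complex /=; apply/andP; split; apply/eqP.
  have := @dot_re_eq [:: (1, ((a +i* b) *: f + f', g)); (- a, (f, g));
    (b, (f, 'i *: g)); (- 1, (f', g))].
  rewrite !big_cons !big_nil/= => H; suff : 1 * dot_re ((a +i* b) *: f + f') g +
    (- a * dot_re f g + (b * dot_re f ('i *: g) + (- 1 * dot_re f' g + 0))) = 0 by lra.
  apply: H => j; rewrite !big_cons big_nil/= /pdot_re ?(addrfctE, scalrfctE) /GRing.scale/=.
  case: (val f j) (val f' j) (val g j) => [p q] [r s] [u v].
  by rewrite /sqmod/=; field.
have := @dot_re_eq [:: (1, ((a +i* b) *: f + f', 'i *: g)); (- a, (f, 'i *: g));
    (- b, (f, g)); (- 1, (f', 'i *: g))].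
rewrite !big_cons !big_nil/= => H; suff : 1 * dot_re ((a +i* b) *: f + f') ('i *: g) +
    (- a * dot_re f ('i *: g) + (- b * dot_re f g + (- 1 * dot_re f' ('i *: g) + 0))) = 0 by lra.
apply: H => j; rewrite !big_cons big_nil/= /pdot_re ?(addrfctE, scalrfctE) /GRing.scale/=.
case: (val f j) (val f' j) (val g j) => [p q] [r s] [u v].
by rewrite /sqmod/=; field.
Qed.

Lemma l2_dotC f g : l2_dot f g = (-1) ^+ false * Num.conj (l2_dot g f).
Proof.
rewrite expr0 mul1r; apply/eqP; rewrite eq_complex /=; apply/andP; split; apply/eqP.
  by rewrite /dot_re (addrC f g); lra.
have := @dot_re_eq [:: (1, (f, 'i *: g)); (1, (g, 'i *: f))].
rewrite !big_cons !big_nil/= => H.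
suff : 1 * dot_re f ('i *: g) + (1 * dot_re g ('i *: f) + 0) = 0 by lra.
apply: H => j; rewrite !big_cons big_nil/= /pdot_re ?(addrfctE, scalrfctE) /GRing.scale/=.
case: (val f j) (val g j) => [p q] [u v].
by rewrite /sqmod/=; field.
Qed.

Lemma l2_dotDr f (a : R[i]) g g' :
  l2_dot f (a *: g + g') = Num.conj a * l2_dot f g + l2_dot f g'.
Proof.
rewrite l2_dotC l2_dotDl rmorphD rmorphM/= expr0 mul1r.
by rewrite (l2_dotC f g) (l2_dotC f g') expr0 !mul1r.
Qed.

Lemma l2_dotxx f : l2_dot f f = `|f| ^+ 2.
Proof.
rewrite l2_normE -rmorphXn sqr_sqrtr ?norm2_ge0//.
apply/eqP; rewrite eq_complex /=; apply/andP; split; apply/eqP.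
  have := @norm2_eq _ _ [:: (1, f + f); (- 4, f)].
  rewrite !big_cons !big_nil/= => H.
  suff : 1 * norm2 (f + f) + (- 4 * norm2 f + 0) = 0 by rewrite /dot_re; lra.
  apply: H => j; rewrite !big_cons big_nil/= ?addrfctE/=.
  by case: (val f j) => p q; rewrite /sqmod/=; ring.
have := @dot_re_eq [:: (1, (f, 'i *: f))].
rewrite !big_cons !big_nil/= => H.
suff : 1 * dot_re f ('i *: f) + 0 = 0 by lra.
apply: H => j; rewrite !big_cons big_nil/= /pdot_re ?(addrfctE, scalrfctE) /GRing.scale/=.
case: (val f j) => [p q].
by rewrite /sqmod/=; field.
Qed.

HB.instance Definition _ := bilinear_isBilinear.Build R[i] l2 l2 R[i]
  *%R (@Num.conj R[i] \; *%R) l2_dot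
  (conj (fun g a f f' => l2_dotDl g a f f') (fun f a g g' => l2_dotDr f a g g')).

HB.instance Definition _ :=
  @isHermitianSesquilinear.Build R[i] l2 false (@Num.conj R[i]) l2_dot l2_dotC.

Lemma l2_dot_gt0 f : f != 0 -> 0 < l2_dot f f.
Proof. by move=> f0; rewrite l2_dotxx exprn_gt0// normr_gt0. Qed.

HB.instance Definition _ := @isDotProduct.Build R[i] l2 l2_dot l2_dot_gt0.

Definition l2_dotp : {dot l2 for (@Num.conj R[i])} := l2_dot.

End l2_dot.

Section l2_complete.
Variables (R : realType) (I : choiceType).
Local Notation l2 := (@l2 R I).

Lemma l2_ballE (f : l2) (e : R) :
  ball f e%:C = [set g : l2 | Num.sqrt (norm2 (f - g)) < e].
Proof. by apply/seteqP; split => g; rewrite -ball_normE/= l2_normE ltcR. Qed.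

(** The coordinates converge because they are 1-Lipschitz; each finite partial sum
of the squared distance to the limit is a limit of partial sums which the Cauchy
condition bounds, hence so is the whole sum. *)
Lemma l2_cauchy_cvg (F : set_system l2) : ProperFilter F -> cauchy F -> cvg F.
Proof.
move=> FF /cauchyP Fc.
have {}Fc (e : R) : 0 < e -> exists f : l2, F [set g | norm2 (f - g) < e].
  move=> e0; have /Fc[f] : 0 < (Num.sqrt e)%:C by rewrite ltcR sqrtr_gt0.
  by rewrite l2_ballE => Ff; exists f; apply: filterS Ff => g/=; rewrite ltr_sqrt.
have coord (p : R[i] -> R) (i : I) : (forall z w, p (z - w) = p z - p w) ->
    (forall z, p z ^+ 2 <= sqmod z) -> cvg ((fun g : l2 => p (val g i) : R^o) @ F).
  move=> pB pn; apply/cauchy_cvgP/cauchyP => /= e e0.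
  have [f Ff] := Fc (e ^+ 2) (exprn_gt0 2 e0).
  exists (p (val f i)); rewrite /fmap/=; apply: filterS Ff => g/= fg.
  rewrite -ball_normE/= -pB -ltr_sqr ?nnegrE// ?(ltW e0)// real_normK ?num_real//.
  by rewrite (le_lt_trans (pn _))// (le_lt_trans (sqmod_le_norm2 (f - g) i)).
pose re (i : I) (g : l2) : R^o := complex.Re (val g i).
pose im (i : I) (g : l2) : R^o := complex.Im (val g i).
have cre i : cvg (re i @ F).
  apply: (coord (@complex.Re R)) => [[a b] [c d]|[a b]] //=.
  by rewrite lerDl sqr_ge0.
have cim i : cvg (im i @ F).
  apply: (coord (@complex.Im R)) => [[a b] [c d]|[a b]] //=.
  by rewrite lerDr sqr_ge0.
pose h i := lim (re i @ F) +i* lim (im i @ F).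
have fh (f : l2) (e : R) (A : set I) : F [set g | norm2 (f - g) < e] ->
    finite_set A -> \sum_(i \in A) sqmod (val f i - h i) <= e.
  move=> Ff finA.
  have H : (fun g : l2 => \sum_(i \in A) ((re i f - re i g) ^+ 2
      + (im i f - im i g) ^+ 2) : R^o) @ F -->
      (\sum_(i \in A) sqmod (val f i - h i) : R^o).
    rewrite fsbig_finite//=; under eq_fun do rewrite fsbig_finite//=.
    elim: (finmap.enum_fset _) => [|i r IHr].
      rewrite big_nil (_ : (fun _ => _) = cst 0); first exact: cvg_cst.
      by apply/funext => g; rewrite big_nil.
    rewrite big_cons (_ : (fun _ => _) = fun g : l2 =>
        ((re i f - re i g) ^+ 2 + (im i f - im i g) ^+ 2) +
        \sum_(j <- r) ((re j f - re j g) ^+ 2 + (im j f - im j g) ^+ 2)); last first.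
      by apply/funext => g; rewrite big_cons.
    apply: cvgD => //; rewrite /sqmod.
    have -> : complex.Re (val f i - h i) = re i f - lim (re i @ F).
      by rewrite /re /h; case: (val f i).
    have -> : complex.Im (val f i - h i) = im i f - lim (im i @ F).
      by rewrite /im /h; case: (val f i).
    by apply: cvgD; rewrite expr2; under eq_fun do rewrite expr2; apply: cvgM;
      apply: cvgB => //; exact: cvg_cst.
  apply: (cvgr_to_le H); apply: filterS Ff => g /= fg.
  rewrite (le_trans _ (ltW fg))// (le_trans _ (fin_le_norm2 (f - g) finA))//.
  rewrite !fsbig_finite//=; apply: ler_sum => i _.
  by rewrite /re /im /sqmod ?fctE/=; move: (sval f i) (sval g i) => [a b] [c d].
have h2 : h \in @l2_pred R I.
  have [f Ff] := Fc 1 ltr01.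
  have fhl : (fun i => val f i - h i) \in @l2_pred R I.
    rewrite unfold_in (@le_lt_trans _ _ 1%E) ?ltry//.
    apply: ge_ereal_sup => _ [A [finA _] <-].
    rewrite fsbig_finite//= sumEFin -fsbig_finite// lee_fin.
    exact: fh.
  rewrite (_ : h = val f - (fun i => val f i - h i)) ?rpredB//; first exact: (valP f).
  by apply/funext => i; rewrite !fctE opprB addrC subrK.
pose hl : l2 := exist _ h h2.
apply/cvg_ex; exists hl; apply/cvg_ballP => e e0.
have [r r0 er] : exists2 r : R, 0 < r & e = r%:C.
  move: e0; case: e => a b; rewrite ltcE/= => /andP[/eqP -> a0].
  by exists a.
have [f Ff] := Fc ((r / 2) ^+ 2) (exprn_gt0 2 (divr_gt0 r0 (ltr0Sn R 1))).
have fhl : norm2 (f - hl) <= (r / 2) ^+ 2.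
  by apply: norm2_le_fin => A finA; apply: fh.
rewrite er; near=> g.
rewrite -ball_normE /=.
have fg : norm2 (f - g) < (r / 2) ^+ 2 by near: g.
rewrite (_ : hl - g = - (f - hl) + (f - g)); last by rewrite opprB addrA subrK.
rewrite (le_lt_trans (ler_normD _ _))// normrN !l2_normE -rmorphD ltcR.
have r2 : 0 <= r / 2 by rewrite divr_ge0 ?ltW.
rewrite [ltRHS](splitr r) ler_ltD//.
  by rewrite -[leRHS]ger0_norm// -sqrtr_sqr ler_wsqrtr.
by rewrite -[ltRHS]ger0_norm// -sqrtr_sqr ltr_sqrt// exprn_gt0// divr_gt0.
Unshelve. all: by end_near. Qed.

HB.instance Definition _ := Uniform_isComplete.Build l2 l2_cauchy_cvg.

Definition l2_hilbert : hilbert R :=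
  @Hilbert R l2 (l2_dotp R I) (@l2_dotxx R I).

End l2_complete.

(** * Characters of the circle *)
Section turn.
Variable R : realType.
Implicit Types s t : R.

Definition turn t : R[i] := cos (2 * pi * t) +i* sin (2 * pi * t).

Lemma turnD s t : turn (s + t) = turn s * turn t.
Proof.
rewrite /turn mulrDr cosD sinD; apply/eqP; rewrite eq_complex /=.
by rewrite eqxx /= addrC mulrC (mulrC (sin _)).
Qed.

Lemma turn0 : turn 0 = 1.
Proof. by rewrite /turn mulr0 cos0 sin0. Qed.

Lemma sqmod_turn t : sqmod (turn t) = 1.
Proof. by rewrite /sqmod/= cos2Dsin2. Qed.

Lemma turn1 : turn 1 = 1.
Proof. by rewrite /turn mulr1 mulr_natl cos2pi sin2pi. Qed.

Lemma turnN t : turn (- t) = (turn t)^*.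
Proof. by rewrite /turn mulrN cosN sinN. Qed.

Lemma turn_int t : t \is a Num.int -> turn t = 1.
Proof.
have nat_turn (n : nat) : turn n%:R = 1.
  by elim: n => [|n IHn]; rewrite ?turn0// -natr1 turnD IHn turn1 mulr1.
move=> /intrP[[n|n] ->]; first exact: nat_turn.
by rewrite NegzE mulrNz turnN nat_turn; apply/eqP; rewrite eq_complex/= oppr0 !eqxx.
Qed.

Lemma turn_eq s t : s - t \is a Num.int -> turn s = turn t.
Proof. by move=> st; rewrite -(subrK t s) turnD turn_int// mul1r. Qed.

Definition turn_dist t : R := sqmod (turn t - 1).

Lemma turn_distE t : turn_dist t = 2 - 2 * cos (2 * pi * t).
Proof.
rewrite /turn_dist /sqmod/=; have := cos2Dsin2 (2 * pi * t); lra.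
Qed.

Lemma turn_dist_eq s t : s - t \is a Num.int -> turn_dist s = turn_dist t.
Proof. by rewrite /turn_dist => /turn_eq ->. Qed.

Lemma turn_distN t : turn_dist (- t) = turn_dist t.
Proof. by rewrite !turn_distE mulrN cosN. Qed.

Lemma turn_dist_ge0 t : 0 <= turn_dist t.
Proof. exact: sqmod_ge0. Qed.

Lemma turn_dist_le4 t : turn_dist t <= 4.
Proof. by rewrite turn_distE; have := cos_geN1 (2 * pi * t); lra. Qed.

(** The representative in [-1/2, 1/2[ of a real number modulo 1. *)
Definition centered t : R := t - (Num.floor (t + 1 / 2))%:~R.

Lemma centered_bounds t : -1 / 2 <= centered t < 1 / 2.
Proof.
have /andP[] := floor_itv (t + 1 / 2).
by rewrite intrD mulr1z /centered => a b; apply/andP; split; lra.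
Qed.

Lemma centered_int t : t - centered t \is a Num.int.
Proof. by rewrite /centered opprB addrC subrK; apply/intrP; exists (Num.floor (t + 1 / 2)). Qed.

Lemma small_int t : -1 < t < 1 -> t \is a Num.int -> t = 0.
Proof.
move=> t1 /intrP[z tz]; move: t1; rewrite tz -[1]/(1%:~R) -mulrNz !ltr_int => z1.
by have -> : z = 0 by lia.
Qed.

Lemma centered_eq s t : t - s \is a Num.int -> -1 / 2 <= s < 1 / 2 -> centered t = s.
Proof.
move=> ts s1; apply/eqP; rewrite -subr_eq0; apply/eqP/small_int.
  by have := centered_bounds t; lra.
rewrite (_ : _ - _ = (t - s) - (t - centered t)); last by ring.
by rewrite rpredB// centered_int.
Qed.

(** At distance at least a quarter turn from 0 the real part of the character is
nonpositive. *)
Lemma turn_dist_far t : 1 / 4 <= `|centered t| -> 2 <= turn_dist t.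
Proof.
move=> ct; rewrite (turn_dist_eq (centered_int t)) turn_distE.
have pi0 := pi_gt0 R.
have -> : cos (2 * pi * centered t) = - cos (2 * pi * `|centered t| - pi).
  rewrite cosB cospi sinpi mulr0 addr0 mulrN1 opprK.
  by case: (ger0P (centered t)) => // _; rewrite mulrN cosN.
suff : 0 <= cos (2 * pi * `|centered t| - pi) by lra.
have c2 : `|centered t| <= 1 / 2 by have := centered_bounds t; rewrite ler_norml; lra.
by apply: cos_ge0_pihalf; apply/andP; split; nra.
Qed.

End turn.

(** * A spectral gap for two twisted shears of the torus *)
Lemma intrB_closed (R : realType) (s t : R) :
  s \is a Num.int -> t \is a Num.int -> s - t \is a Num.int.
Proof. exact: rpredB. Qed.

Lemma intrD_closed (R : realType) (s t : R) :
  s \is a Num.int -> t \is a Num.int -> s + t \is a Num.int.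
Proof. exact: rpredD. Qed.

Lemma intrN_closed (R : realType) (s : R) :
  s \is a Num.int -> - s \is a Num.int.
Proof. by rewrite rpredN. Qed.

Ltac int_step := match goal with
  | H : is_true (_ \is a Num.int) |- _ => exact: H
  | H : forall _, is_true (_ \is a Num.int) |- _ => exact: H
  | |- _ => exact: centered_int
  | |- is_true (- _ \is a Num.int) => apply: intrN_closed
  | |- is_true (_ - _ \is a Num.int) => apply: intrB_closed
  | |- is_true (_ + _ \is a Num.int) => apply: intrD_closed
  end.

(** The finite set [Y] stands for a set of points of the torus with coordinates
[t1] and [t2] modulo 1; only the two permutations and the way they move the
coordinates matter, so that [Y] may also be a set of pairs which maps to the torus. *)
Section gap.
Variables (R : realType) (Y : finType) (L Li U Ui : Y -> Y) (t1 t2 : Y -> R).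
Variable f : Y -> R[i].
Hypotheses (LK : cancel L Li) (LiK : cancel Li L).
Hypotheses (UK : cancel U Ui) (UiK : cancel Ui U).
Hypothesis braid : forall v, L (U (L v)) = U (L (U v)).
Hypothesis t1L : forall v, t1 (L v) - (t1 v + t2 v) \is a Num.int.
Hypothesis t2L : forall v, t2 (L v) - t2 v \is a Num.int.
Hypothesis t1U : forall v, t1 (U v) - t1 v \is a Num.int.
Hypothesis t2U : forall v, t2 (U v) - (t2 v - t1 v) \is a Num.int.
Hypothesis f_supp : forall v, f v != 0 ->
  ~~ ((t1 v \is a Num.int) && (t2 v \is a Num.int)).

Let mass : R := \sum_v sqmod (f v).
Let dL v : R := sqmod (f v - turn (t1 v) * f (L v)).
Let dU v : R := sqmod (f v - f (U v)).
Let D : R := \sum_v dL v + \sum_v dU v.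

Let sumL (h : Y -> R) : \sum_v h (L v) = \sum_v h v.
Proof. by rewrite [RHS](reindex_inj (can_inj LK)). Qed.
Let sumU (h : Y -> R) : \sum_v h (U v) = \sum_v h v.
Proof. by rewrite [RHS](reindex_inj (can_inj UK)). Qed.
Let sumLi (h : Y -> R) : \sum_v h (Li v) = \sum_v h v.
Proof. by rewrite [RHS](reindex_inj (can_inj LiK)). Qed.
Let sumUi (h : Y -> R) : \sum_v h (Ui v) = \sum_v h v.
Proof. by rewrite [RHS](reindex_inj (can_inj UiK)). Qed.

Let int_eq (x y z : R) : x - y \is a Num.int -> y - z \is a Num.int ->
  x - z \is a Num.int.
Proof. by move=> xy yz; rewrite -(subrK y x) -addrA rpredD. Qed.

(** With (g1 f)(v) = turn (t1 v) f (L v) and (g2 f)(v) = f (U v), both g1 g2 g1 f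
and g2 g1 g2 f evaluate f at the same point by the braid relation, with factors
whose ratio is turn (t1 + t2). Their difference is a sum of six terms, each of
which is a displacement of f moved by a unitary. The sum is then read at the
image point, where t1 + t2 has become t1 - t2. *)
Lemma gap_translation :
  \sum_v sqmod (f v) * turn_dist (t1 v - t2 v) <= 18 * D.
Proof.
rewrite -sumL -sumU -sumL.
have tS v : turn_dist (t1 (L (U (L v))) - t2 (L (U (L v)))) = turn_dist (t1 v + t2 v).
  apply: turn_dist_eq.
  have a1 := t1L (U (L v)); have a2 := t2L (U (L v)).
  have b1 := t1U (L v); have b2 := t2U (L v); have c1 := t1L v; have c2 := t2L v.
  rewrite (_ : _ - _ = (t1 (L (U (L v))) - (t1 (U (L v)) + t2 (U (L v))))
    + (t1 (U (L v)) - t1 (L v)) + (t1 (L v) - (t1 v + t2 v))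
    - (t2 (L (U (L v))) - t2 (U (L v)))); last by ring.
  by do !int_step.
have -> : 18 * D = \sum_v 2 * (3 * (dL (U (L v)) + dU (L v) + dL v)
    + 3 * (dU (L (U v)) + dL (U v) + dU v)).
  have sum3 (a b c : Y -> R) :
      \sum_v (a v + b v + c v) = \sum_v a v + \sum_v b v + \sum_v c v.
    by rewrite !big_split.
  rewrite -mulr_sumr big_split/= -!mulr_sumr.
  rewrite (sum3 (fun v => dL (U (L v))) (fun v => dU (L v)) dL).
  rewrite (sum3 (fun v => dU (L (U v))) (fun v => dL (U v)) dU) /=.
  have -> : \sum_v dL (U (L v)) = \sum_v dL v.
    exact: etrans (sumL (fun v => dL (U v))) (sumU dL).
  have -> : \sum_v dU (L (U v)) = \sum_v dU v.
    exact: etrans (sumU (fun v => dU (L v))) (sumL dU).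
  by rewrite (sumL dU) (sumU dL) /D; ring.
apply: ler_sum => v _; rewrite tS.
(* Each of the two groups of three terms telescopes, the generators being removed
   from the innermost to the outermost. *)
have -> : sqmod (f (L (U (L v)))) * turn_dist (t1 v + t2 v) =
    sqmod (((turn (t1 v) * turn (t1 (U (L v))) * f (L (U (L v))) - turn (t1 v) * f (U (L v)))
     + (turn (t1 v) * f (U (L v)) - turn (t1 v) * f (L v))
     + (turn (t1 v) * f (L v) - f v))
     + - ((turn (t1 (U v)) * f (U (L (U v))) - turn (t1 (U v)) * f (L (U v)))
     + (turn (t1 (U v)) * f (L (U v)) - f (U v)) + (f (U v) - f v))).
  have -> : turn (t1 (U (L v))) = turn (t1 v + t2 v).
    by apply: turn_eq; apply: int_eq (t1U _) _; exact: t1L.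
  have -> : turn (t1 (U v)) = turn (t1 v) by exact/turn_eq/t1U.
  rewrite -braid /turn_dist -sqmodM -[LHS]mul1r -(sqmod_turn (t1 v)) -sqmodM.
  by congr sqmod; ring.
have dLE w : sqmod (turn (t1 w) * f (L w) - f w) = dL w by rewrite -sqmodN opprB.
have dUE w : sqmod (f (U w) - f w) = dU w by rewrite -sqmodN opprB.
have phase (a : R) z w : sqmod (turn a * z - turn a * w) = sqmod (z - w).
  by rewrite -mulrBr sqmodM sqmod_turn mul1r.
rewrite (le_trans (sqmodD2 _ _))// ler_pM2l// sqmodN lerD// (le_trans (sqmodD3 _ _ _))//.
  by rewrite ler_pM2l// -mulrA !phase dLE dUE dLE.
by rewrite ler_pM2l// phase dUE dLE dUE.
Qed.

(** The composition with L turns t1 - t2 into t1, and almost preserves |f|. *)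
Lemma gap_t1 : \sum_v sqmod (f v) * turn_dist (t1 v) <= 44 * D.
Proof.
have -> : 44 * D = 2 * (18 * D) + 8 * D by ring.
have DL : \sum_v dL v <= D by rewrite lerDl sumr_ge0// => v _; exact: sqmod_ge0.
apply: (@le_trans _ _ (2 * (\sum_v sqmod (f v) * turn_dist (t1 v - t2 v))
  + 8 * \sum_v dL v)); last first.
  by have := gap_translation; lra.
rewrite -[X in 2 * X + _]sumL !mulr_sumr -big_split/=; apply: ler_sum => v _.
have -> : turn_dist (t1 (L v) - t2 (L v)) = turn_dist (t1 v).
  apply: turn_dist_eq.
  rewrite (_ : _ - _ = (t1 (L v) - (t1 v + t2 v)) - (t2 (L v) - t2 v)); last by ring.
  by rewrite rpredB.
have : sqmod (f v) <= 2 * (dL v + sqmod (f (L v))).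
  have := sqmodD2 (f v - turn (t1 v) * f (L v)) (turn (t1 v) * f (L v)).
  by rewrite subrK sqmodM sqmod_turn mul1r.
have := turn_dist_ge0 (t1 v); have := turn_dist_le4 (t1 v).
have := sqmod_ge0 (f (L v)); have : 0 <= dL v by exact: sqmod_ge0.
have := sqmod_ge0 (f v).
move: (sqmod _) (dL v) (sqmod _) (turn_dist _) => a d b c; nra.
Qed.

(** The composition with U^-1 turns t1 - t2 into - t2. *)
Lemma gap_t2 : \sum_v sqmod (f v) * turn_dist (t2 v) <= 44 * D.
Proof.
have -> : 44 * D = 2 * (18 * D) + 8 * D by ring.
have DU : \sum_v dU v <= D by rewrite lerDr sumr_ge0// => v _; exact: sqmod_ge0.
apply: (@le_trans _ _ (2 * (\sum_v sqmod (f v) * turn_dist (t1 v - t2 v))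
  + 8 * \sum_v dU v)); last first.
  by have := gap_translation; lra.
rewrite -[leLHS]sumU !mulr_sumr -big_split/=; apply: ler_sum => v _.
have -> : turn_dist (t2 (U v)) = turn_dist (t1 v - t2 v).
  rewrite -turn_distN; apply: turn_dist_eq.
  by rewrite (_ : _ - _ = - (t2 (U v) - (t2 v - t1 v))) ?rpredN//; ring.
have : sqmod (f (U v)) <= 2 * (dU v + sqmod (f v)).
  have := sqmodD2 (f (U v) - f v) (f v); rewrite subrK.
  by rewrite -[sqmod (_ - _)]sqmodN opprB.
have := turn_dist_ge0 (t1 v - t2 v); have := turn_dist_le4 (t1 v - t2 v).
have := sqmod_ge0 (f (U v)); have : 0 <= dU v by exact: sqmod_ge0.
have := sqmod_ge0 (f v).
move: (sqmod _) (dU v) (sqmod _) (turn_dist _) => a d b c; nra.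
Qed.

Let x v : R := centered (t1 v).
Let y v : R := centered (t2 v).
Let near v := (`|x v| < 1 / 4) && (`|y v| < 1 / 4).

(** Where one of the coordinates is at least 1/4, one of the two characters is at
squared distance at least 2 from 1. *)
Lemma gap_far : \sum_(v | ~~ near v) sqmod (f v) <= 44 * D.
Proof.
have H : \sum_(v | ~~ near v) sqmod (f v) <=
    \sum_v sqmod (f v) * ((turn_dist (t1 v) + turn_dist (t2 v)) / 2).
  rewrite big_mkcond /=; apply: ler_sum => v _; have f0 := sqmod_ge0 (f v).
  have a0 := turn_dist_ge0 (t1 v); have b0 := turn_dist_ge0 (t2 v).
  case: ifPn => [|_]; last by rewrite mulr_ge0// divr_ge0// addr_ge0.
  rewrite negb_and -!leNgt => ab; rewrite ler_peMr// ler_pdivlMr// mul1r.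
  by case/orP: ab => /turn_dist_far; lra.
rewrite (le_trans H)//; have := gap_t1; have := gap_t2.
under [X in _ -> _ -> X <= _]eq_bigr do rewrite mulrA mulrDr.
rewrite -mulr_suml big_split/=; lra.
Qed.

Let xL v : near v -> x (L v) = x v + y v.
Proof.
rewrite /near !ltr_norml => /andP[vx vy]; apply: centered_eq.
  rewrite (_ : _ - _ = (t1 (L v) - (t1 v + t2 v)) + (t1 v - x v) + (t2 v - y v)); last by ring.
  by do !int_step.
by lra.
Qed.

Let yL v : y (L v) = y v.
Proof.
apply: centered_eq; last exact: centered_bounds.
exact: int_eq (t2L _) (centered_int _).
Qed.

Let xU v : x (U v) = x v.
Proof.
apply: centered_eq; last exact: centered_bounds.
exact: int_eq (t1U _) (centered_int _).
Qed.

Let yU v : near v -> y (U v) = y v - x v.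
Proof.
rewrite /near !ltr_norml => /andP[vx vy]; apply: centered_eq.
  rewrite (_ : _ - _ = (t2 (U v) - (t2 v - t1 v)) - (t1 v - x v) + (t2 v - y v)); last by ring.
  by do !int_step.
by lra.
Qed.

Let xLi v : near v -> x (Li v) = x v - y v.
Proof.
move=> nv; have := nv; rewrite /near !ltr_norml => /andP[vx vy]; apply: centered_eq.
  have a := t1L (Li v); have b := t2L (Li v); rewrite LiK in a b.
  rewrite (_ : _ - _ = - (t1 v - (t1 (Li v) + t2 (Li v))) + (t2 v - t2 (Li v))
    + (t1 v - x v) - (t2 v - y v)); last by ring.
  by do !int_step.
by lra.
Qed.

Let yLi v : y (Li v) = y v.
Proof. by rewrite -[in RHS](LiK v) yL. Qed.

Let xUi v : x (Ui v) = x v.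
Proof. by rewrite -[in RHS](UiK v) xU. Qed.

Let yUi v : near v -> y (Ui v) = y v + x v.
Proof.
move=> nv; have := nv; rewrite /near !ltr_norml => /andP[vx vy]; apply: centered_eq.
  have a := t1U (Ui v); have b := t2U (Ui v); rewrite UiK in a b.
  rewrite (_ : _ - _ = - (t2 v - (t2 (Ui v) - t1 (Ui v))) - (t1 v - t1 (Ui v))
    + (t1 v - x v) + (t2 v - y v)); last by ring.
  by do !int_step.
by lra.
Qed.

(** The two quadrants with coordinates of the same sign, closed on one side only:
the images by L and U^-1 are then disjoint, and [sector] and [sector'] together
make up the punctured plane. *)
Let sector v := ((0 < x v) && (0 <= y v)) || ((x v < 0) && (y v <= 0)).
Let sector' v := ((x v <= 0) && (0 < y v)) || ((0 <= x v) && (y v < 0)).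

(** An almost invariant mass cannot decrease much when a set is pushed forward by
a permutation; the constant 3/2 leaves room for two disjoint images to outweigh
the set itself. *)
Let push (P Q : pred Y) (s : Y -> Y) (d : Y -> R) :
  (forall h : Y -> R, \sum_v h (s v) = \sum_v h v) ->
  (forall v, sqmod (f v) <= 3 / 2 * sqmod (f (s v)) + 3 * d v) ->
  (forall v, 0 <= d v) -> (forall v, P v -> Q (s v)) ->
  \sum_(v | P v) sqmod (f v) <= 3 / 2 * \sum_(v | Q v) sqmod (f v) + 3 * \sum_v d v.
Proof.
move=> sums fd d0 PQ; rewrite [X in 3 / 2 * X]big_mkcond/= -sums big_mkcond/=.
rewrite !mulr_sumr -big_split/=; apply: ler_sum => v _.
have := fd v; have := d0 v; have := sqmod_ge0 (f (s v)).
by case: ifPn => [/PQ ->|_] //; case: ifPn => _; lra.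
Qed.

Let dUi v : R := dU (Ui v).
Let dLi v : R := dL (Li v).

Let fL v : sqmod (f v) <= 3 / 2 * sqmod (f (L v)) + 3 * dL v.
Proof.
have := sqmodD_half (turn (t1 v) * f (L v)) (f v - turn (t1 v) * f (L v)).
by rewrite addrC subrK sqmodM sqmod_turn mul1r /dL; lra.
Qed.

Let fU v : sqmod (f v) <= 3 / 2 * sqmod (f (U v)) + 3 * dU v.
Proof.
have := sqmodD_half (f (U v)) (f v - f (U v)).
by rewrite addrC subrK /dU; lra.
Qed.

Let fLi v : sqmod (f v) <= 3 / 2 * sqmod (f (Li v)) + 3 * dLi v.
Proof.
have := sqmodD_half (f (Li v)) (turn (t1 (Li v)) * f v - f (Li v)).
rewrite addrC subrK sqmodM sqmod_turn mul1r.
by rewrite -[sqmod (_ - _)]sqmodN opprB /dLi /dL LiK; lra.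
Qed.

Let fUi v : sqmod (f v) <= 3 / 2 * sqmod (f (Ui v)) + 3 * dUi v.
Proof.
have := sqmodD_half (f (Ui v)) (f v - f (Ui v)).
rewrite addrC subrK.
by rewrite -[sqmod (_ - _)]sqmodN opprB /dUi /dU UiK; lra.
Qed.

(** Near 0, L maps the sector to its part where |y| < |x|, and U^-1 to its part where
|x| <= |y|. *)
Lemma gap_sector : 2 * \sum_(v | sector v && near v) sqmod (f v) <=
  3 / 2 * \sum_(v | sector v) sqmod (f v) + 3 * D.
Proof.
pose P v := sector v && near v; pose Q v := sector v && (`|y v| < `|x v|).
pose Q' v := sector v && ~~ (`|y v| < `|x v|).
have PQ v : P v -> Q (L v).
  rewrite /P /Q /sector => /andP[sv nv]; rewrite xL// yL.
  by case/orP: sv => /andP[a b]; apply/andP; split; do ?[case: ger0P => ?]; lra.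
have PQ' v : P v -> Q' (Ui v).
  rewrite /P /Q' /sector => /andP[sv nv]; rewrite xUi yUi//.
  by case/orP: sv => /andP[a b]; apply/andP; split; rewrite -?leNgt; do ?[case: ger0P => ?]; lra.
have A := push sumL fL (fun v => sqmod_ge0 _) PQ.
have B := push sumUi fUi (fun v => sqmod_ge0 _) PQ'.
rewrite sumUi in B.
have : \sum_(v | sector v) sqmod (f v) =
   \sum_(v | Q v) sqmod (f v) + \sum_(v | Q' v) sqmod (f v) by rewrite -bigID.
by rewrite /P in A B; rewrite /D; lra.
Qed.

Lemma gap_sector' : 2 * \sum_(v | sector' v && near v) sqmod (f v) <=
  3 / 2 * \sum_(v | sector' v) sqmod (f v) + 3 * D.
Proof.
pose P v := sector' v && near v; pose Q v := sector' v && (`|y v| <= `|x v|).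
pose Q' v := sector' v && ~~ (`|y v| <= `|x v|).
have PQ v : P v -> Q (Li v).
  rewrite /P /Q /sector' => /andP[sv nv]; rewrite xLi// yLi.
  by case/orP: sv => /andP[a b]; apply/andP; split; do ?[case: ger0P => ?]; lra.
have PQ' v : P v -> Q' (U v).
  rewrite /P /Q' /sector' => /andP[sv nv]; rewrite xU yU//.
  by case/orP: sv => /andP[a b]; apply/andP; split; rewrite -?ltNge; do ?[case: ger0P => ?]; lra.
have A := push sumLi fLi (fun v => sqmod_ge0 _) PQ.
have B := push sumU fU (fun v => sqmod_ge0 _) PQ'.
rewrite sumLi in A.
have : \sum_(v | sector' v) sqmod (f v) =
   \sum_(v | Q v) sqmod (f v) + \sum_(v | Q' v) sqmod (f v) by rewrite -bigID.
by rewrite /P in A B; rewrite /D; lra.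
Qed.

(** As 2 * (near mass) is at most 3/2 * mass + 6 * D by the two sectors, the mass is
at most 4 * (far mass) + 12 * D, and the far mass is at most 44 * D. *)
Lemma spectral_gap : mass <= 188 * D.
Proof.
have supp v : sqmod (f v) != 0 -> sector v || sector' v.
  move=> fv; have /f_supp : f v != 0.
    by apply: contraNneq fv => ->; rewrite sqmod0.
  apply: contraNT => sv.
  have [x0 y0] : x v = 0 /\ y v = 0.
    move: sv; rewrite /sector /sector'.
    by case: (ltgtP (x v) 0); case: (ltgtP (y v) 0) => //= -> ->.
  have := centered_int (t1 v); have := centered_int (t2 v).
  by rewrite -/(x v) -/(y v) x0 y0 !subr0 => -> ->.
have E1 : \sum_(v | sector v) sqmod (f v) + \sum_(v | sector' v) sqmod (f v) <= mass.
  rewrite /mass big_mkcond/= [X in _ + X]big_mkcond/= -big_split/=.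
  apply: ler_sum => v _; have f0 := sqmod_ge0 (f v).
  case: ifPn => sv; case: ifPn => sv'; rewrite ?addr0 ?add0r//.
  exfalso; move: sv sv'; rewrite /sector /sector'.
  by case: (ltgtP (x v) 0); case: (ltgtP (y v) 0).
have E2 : mass <= \sum_(v | sector v && near v) sqmod (f v)
    + \sum_(v | sector' v && near v) sqmod (f v) + \sum_(v | ~~ near v) sqmod (f v).
  rewrite /mass [X in _ <= X + _ + _]big_mkcond/= [X in _ + X + _]big_mkcond/=.
  rewrite [X in _ + _ + X]big_mkcond/=.
  rewrite -!big_split/=; apply: ler_sum => v _.
  have [->|/supp sv] := eqVneq (sqmod (f v)) 0; first by rewrite !if_same !addr0.
  have f0 := sqmod_ge0 (f v); move: sv.
  by case: (sector v); case: (sector' v); case: (near v) => //= _; lra.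
have := gap_sector; have := gap_sector'; have := gap_far.
have : 0 <= \sum_(v | ~~ near v) sqmod (f v) by rewrite sumr_ge0// => v _; exact: sqmod_ge0.
lra.
Qed.

End gap.

(** * Torsion points of the torus *)

(** The ordinal type stands for Z/(N+2), whose ring structure makes the shears and
their inverses polynomial. *)
Definition torus N : finType := ('I_N.+2 * 'I_N.+2)%type.

Section torus.
Variable N : nat.
Implicit Types k : torus N.

Definition shearL k : torus N := (k.1 + k.2, k.2).
Definition shearLi k : torus N := (k.1 - k.2, k.2).
Definition shearU k : torus N := (k.1, k.2 - k.1).
Definition shearUi k : torus N := (k.1, k.2 + k.1).

Lemma shearLK : cancel shearL shearLi.
Proof. by case=> a b; rewrite /shearL /shearLi/= addrK. Qed.
Lemma shearLiK : cancel shearLi shearL.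
Proof. by case=> a b; rewrite /shearL /shearLi/= subrK. Qed.
Lemma shearUK : cancel shearU shearUi.
Proof. by case=> a b; rewrite /shearU /shearUi/= subrK. Qed.
Lemma shearUiK : cancel shearUi shearU.
Proof. by case=> a b; rewrite /shearU /shearUi/= addrK. Qed.

Lemma shear_braid k : shearL (shearU (shearL k)) = shearU (shearL (shearU k)).
Proof.
case: k => a b; rewrite /shearL /shearU/=.
rewrite [a + (b - a)]addrC subrK [a + b + _]addrC subrK.
by congr (_, _); rewrite opprD addrA.
Qed.

(** Both coordinates are annihilated together only by 0: the point has order exactly
N+2. Written with annihilators, the condition is visibly invariant under the
shears. *)
Definition primitive k : bool :=
  [forall c : 'I_N.+2, (c * k.1 == 0) && (c * k.2 == 0) ==> (c == 0)].

Lemma primitive_shearL k : primitive (shearL k) = primitive k.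
Proof.
apply: eq_forallb => c /=; congr (_ ==> _); apply: andb_id2r => /eqP c2.
by rewrite mulrDr c2 addr0.
Qed.

Lemma primitive_shearU k : primitive (shearU k) = primitive k.
Proof.
apply: eq_forallb => c /=; congr (_ ==> _); apply: andb_id2l => /eqP c1.
by rewrite mulrBr c1 subr0.
Qed.

Lemma primitive_e1 : primitive (1, 0).
Proof. by apply/forallP => c; apply/implyP => /andP[]; rewrite mulr1. Qed.

End torus.

Section angle.
Variables (R : realType) (N : nat).
Implicit Types a b : 'I_N.+2.

Definition angle a : R := (a : nat)%:R / N.+2%:R.

Lemma angleD a b : angle (a + b) - (angle a + angle b) \is a Num.int.
Proof.
have n0 : N.+2%:R != 0 :> R by rewrite pnatr_eq0.
have : (a + b)%N = ((a + b) %/ N.+2 * N.+2 + (a + b)%R)%N := divn_eq _ _.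
move=> /(congr1 (fun m => m%:R : R)); rewrite !natrD natrM => E.
rewrite (_ : _ - _ = - ((a + b) %/ N.+2)%N%:R); last first.
  rewrite /angle -mulrDl E; move: (N.+2%:R) n0 => n n0.
  by field.
by rewrite rpredN; apply/intrP; exists ((a + b) %/ N.+2)%N.
Qed.

Lemma angleB a b : angle (a - b) - (angle a - angle b) \is a Num.int.
Proof.
have := angleD (a - b) b; rewrite subrK => H.
by rewrite (_ : _ - _ = - (angle a - (angle (a - b) + angle b))) ?rpredN//; ring.
Qed.

End angle.

(** Clear denominators in b / (M+2) - a / (N+2) = z. *)
Lemma angle_dvdn (R : realType) N M (a : 'I_N.+2) (b : 'I_M.+2) :
  angle R b - angle R a \is a Num.int -> (N.+2 %| M.+2 * a)%N.
Proof.
move=> /intrP[z]; rewrite /angle => H.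
have n0 : N.+2%:R != 0 :> R by rewrite pnatr_eq0.
have m0 : M.+2%:R != 0 :> R by rewrite pnatr_eq0.
have : (M.+2%:Z * a%:Z)%:~R = ((b%:Z - z * M.+2%:Z) * N.+2%:Z)%:~R :> R.
  rewrite !intrM intrB intrM -H -!pmulrn.
  move: (N.+2%:R) (M.+2%:R) n0 m0 => n m n0 m0.
  by field; rewrite n0 m0.
move=> /intr_inj E.
have : (N.+2%:Z %| M.+2%:Z * a%:Z)%Z by rewrite E dvdz_mull.
by rewrite -PoszM.
Qed.

(** M+2 annihilates k modulo N+2, hence is divisible by N+2, and conversely. *)
Lemma primitive_angle_neq (R : realType) N M (k : torus N) (l : torus M) :
  primitive k -> primitive l ->
  angle R l.1 - angle R k.1 \is a Num.int -> angle R l.2 - angle R k.2 \is a Num.int ->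
  N = M.
Proof.
have dvd N' M' (k' : torus N') : primitive k' -> (N'.+2 %| M'.+2 * k'.1)%N ->
    (N'.+2 %| M'.+2 * k'.2)%N -> (N'.+2 %| M'.+2)%N.
  move=> /forallP/(_ (inZp M'.+2)) /implyP p k1 k2.
  have z0 (a : 'I_N'.+2) : (N'.+2 %| M'.+2 * a)%N -> inZp M'.+2 * a == 0.
    by rewrite /dvdn => ma; rewrite -val_eqE /= modnMml.
  have := p; rewrite !z0// => /(_ isT); rewrite -val_eqE/=.
  by [].
move=> kP lP a1 a2.
have kl := dvd _ _ _ kP (angle_dvdn a1) (angle_dvdn a2).
have b1 : angle R k.1 - angle R l.1 \is a Num.int by rewrite -rpredN opprB.
have b2 : angle R k.2 - angle R l.2 \is a Num.int by rewrite -rpredN opprB.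
have lk := dvd _ _ _ lP (angle_dvdn b1) (angle_dvdn b2).
by have := dvdn_leq (ltn0Sn _) kl; have := dvdn_leq (ltn0Sn _) lk; lia.
Qed.

Section block.
Variables (R : realType) (N M : nat).
Hypothesis NM : N <> M.
Let Y : finType := (torus N * torus M)%type.

(** For three vectors, |a + b + c|^2 = 3 (|a|^2 + |b|^2 + |c|^2) - |a - b|^2 -
|a - c|^2 - |b - c|^2; the gap bounds from below the sum of two of the
subtracted terms. *)
Lemma block_bound (f : Y -> R[i]) :
  \sum_v sqmod ((primitive v.1 && primitive v.2)%:R *
    (f v + turn (angle R v.2.1 - angle R v.1.1) * f (shearL v.1, shearL v.2)
         + f (shearU v.1, shearU v.2)))
  <= (9 - 1 / 188) * \sum_v sqmod (f v).
Proof.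
pose LY (v : Y) : Y := (shearL v.1, shearL v.2).
pose LYi (v : Y) : Y := (shearLi v.1, shearLi v.2).
pose UY (v : Y) : Y := (shearU v.1, shearU v.2).
pose UYi (v : Y) : Y := (shearUi v.1, shearUi v.2).
have LK : cancel LY LYi by case=> a b; rewrite /LY /LYi/= !shearLK.
have LiK : cancel LYi LY by case=> a b; rewrite /LY /LYi/= !shearLiK.
have UK : cancel UY UYi by case=> a b; rewrite /UY /UYi/= !shearUK.
have UiK : cancel UYi UY by case=> a b; rewrite /UY /UYi/= !shearUiK.
have braid v : LY (UY (LY v)) = UY (LY (UY v)).
  by case: v => a b; rewrite /LY /UY/= !shear_braid.
pose t1 (v : Y) : R := angle R v.2.1 - angle R v.1.1.
pose t2 (v : Y) : R := angle R v.2.2 - angle R v.1.2.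
have t1L v : t1 (LY v) - (t1 v + t2 v) \is a Num.int.
  have a := @angleD R _ v.1.1 v.1.2; have b := @angleD R _ v.2.1 v.2.2.
  rewrite (_ : _ - _ = (angle R (v.2.1 + v.2.2) - (angle R v.2.1 + angle R v.2.2))
    - (angle R (v.1.1 + v.1.2) - (angle R v.1.1 + angle R v.1.2))).
    exact: rpredB.
  by rewrite /t1 /t2 /LY/=; ring.
have t2L v : t2 (LY v) - t2 v \is a Num.int by rewrite subrr.
have t1U v : t1 (UY v) - t1 v \is a Num.int by rewrite subrr.
have t2U v : t2 (UY v) - (t2 v - t1 v) \is a Num.int.
  have a := @angleB R _ v.1.2 v.1.1; have b := @angleB R _ v.2.2 v.2.1.
  rewrite (_ : _ - _ = (angle R (v.2.2 - v.2.1) - (angle R v.2.2 - angle R v.2.1))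
    - (angle R (v.1.2 - v.1.1) - (angle R v.1.2 - angle R v.1.1))).
    exact: rpredB.
  by rewrite /t1 /t2 /UY/=; ring.
pose p (v : Y) := primitive v.1 && primitive v.2.
pose g v : R[i] := (p v)%:R * f v.
have pL v : p (LY v) = p v by rewrite /p /LY/= !primitive_shearL.
have pU v : p (UY v) = p v by rewrite /p /UY/= !primitive_shearU.
have g_supp v : g v != 0 -> ~~ ((t1 v \is a Num.int) && (t2 v \is a Num.int)).
  rewrite /g; case pv : (p v); last by rewrite mul0r eqxx.
  move=> _; apply/negP => /andP[a1 a2]; case/andP: pv => p1 p2.
  exact: NM (primitive_angle_neq p1 p2 a1 a2).
have gap := spectral_gap LK LiK UK UiK braid t1L t2L t1U t2U g_supp.
have sumL (h : Y -> R) : \sum_v h (LY v) = \sum_v h v.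
  by rewrite [RHS](reindex_inj (can_inj LK)).
have sumU (h : Y -> R) : \sum_v h (UY v) = \sum_v h v.
  by rewrite [RHS](reindex_inj (can_inj UK)).
have gf : \sum_v sqmod (g v) <= \sum_v sqmod (f v).
  apply: ler_sum => v _; rewrite /g; case: (p v); rewrite ?mul1r// mul0r sqmod0.
  exact: sqmod_ge0.
apply: (@le_trans _ _ (\sum_v (3 * (sqmod (g v) + sqmod (g (LY v)) + sqmod (g (UY v)))
    - (sqmod (g v - turn (t1 v) * g (LY v)) + sqmod (g v - g (UY v)))))).
  apply: ler_sum => v _; rewrite -/(LY v) -/(UY v) -/(t1 v) -/(p v).
  have -> : (p v)%:R * (f v + turn (t1 v) * f (LY v) + f (UY v)) =
      g v + turn (t1 v) * g (LY v) + g (UY v).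
    by rewrite /g pL pU; ring.
  have <- : sqmod (turn (t1 v) * g (LY v)) = sqmod (g (LY v)).
    by rewrite sqmodM sqmod_turn mul1r.
  move: (g v) (turn _ * _) (g (UY v)) => [a b] [c d] [q r]; rewrite /sqmod/=.
  by have := sqr_ge0 (c - q); have := sqr_ge0 (d - r); rewrite !sqrrB; lra.
move: gap gf (sumL (fun v => sqmod (g v))) (sumU (fun v => sqmod (g v))).
move: (@sqmod R) => q; rewrite sumrB -mulr_sumr !big_split/=. lra.
Qed.

End block.

(** * Spans of weighted composition operators *)

(** The operators f |-> (i |-> c i * f (s i)) are contractions of l2; they include the
permutation operators with phases, and their restrictions to unions of orbits. *)
Section weighted_composition.
Variables (R : realType) (I : choiceType).
Local Notation l2 := (@l2 R I).
Variables (c : I -> R[i]) (s : I -> I).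
Hypotheses (c1 : forall i, sqmod (c i) <= 1) (s_inj : injective s).

Lemma sqsum_wcomp_le (f : I -> R[i]) :
  (sqsum (fun i => (c i * f (s i))%R) <= sqsum f)%E.
Proof.
apply: (@le_trans _ _ (\esum_(i in setT) (sqmod (f (s i)))%:E)%E).
  apply: le_esum => i _; rewrite lee_fin sqmodM.
  by rewrite ler_piMl ?sqmod_ge0.
rewrite -(esum_image setT s (fun i => (sqmod (f i))%:E)); last first.
  by move=> i j _ _; exact: s_inj.
apply: ge_ereal_sup => _ [X [finX _] <-].
by apply: esum_ge; exists X.
Qed.

Lemma wcomp_subproof (f : l2) : (fun i => c i * val f (s i)) \in @l2_pred R I.
Proof. exact: le_lt_trans (sqsum_wcomp_le _) (valP f). Qed.

Definition wcomp (f : l2) : l2 :=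
  exist (fun g => g \in @l2_pred R I) _ (wcomp_subproof f).

Lemma wcomp_is_linear : linear wcomp.
Proof.
move=> a f g; apply/val_inj/funext => i /=.
by rewrite !fctE /GRing.scale/=; ring.
Qed.

Lemma norm2_wcomp_le f : norm2 (wcomp f) <= norm2 f.
Proof. by rewrite -lee_fin -!norm2E sqsum_wcomp_le. Qed.

Lemma rnorm_wcomp_le f : rnorm (wcomp f) <= rnorm f.
Proof. by rewrite !l2_rnorm ler_wsqrtr// norm2_wcomp_le. Qed.

End weighted_composition.

Section l2_delta.
Variables (R : realType) (I : choiceType).

Lemma sqsum_delta (i : I) : sqsum (fun j => (j == i)%:R : R[i]) = 1%E.
Proof.
transitivity (\esum_(j in [set i]) (1 : R)%:E)%E; last by rewrite esum_set1.
rewrite [RHS]esum_mkcond; apply: eq_esum => j _.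
case: ifPn => [|ji]; first by rewrite inE => ->; rewrite eqxx sqmod1.
by rewrite (negbTE (_ : j != i)) ?sqmod0//; apply: contra ji => /eqP ->; rewrite inE.
Qed.

Lemma l2_delta_subproof (i : I) : (fun j => (j == i)%:R) \in @l2_pred R I.
Proof. by rewrite unfold_in sqsum_delta ltry. Qed.

Definition l2_delta i : @l2 R I :=
  exist (fun g => g \in @l2_pred R I) _ (l2_delta_subproof i).

Lemma norm2_delta i : norm2 (l2_delta i) = 1.
Proof. by apply: EFin_inj; rewrite -norm2E sqsum_delta. Qed.

End l2_delta.

Section rnorm.
Variables (R : realType) (V : normedModType R[i]).
Implicit Types x y : V.

Lemma rnormZc (a : R[i]) x : rnorm (a *: x) = Num.sqrt (sqmod a) * rnorm x.
Proof.
by rewrite {1}/rnorm normrZ normc_sqmod (rnormE x)/= mulr0 subr0.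
Qed.

Lemma rnorm_small0 x (k : R) : (forall e, 0 < e -> rnorm x <= k * e) -> x = 0.
Proof.
move=> H; apply: rnorm_eq0; apply/eqP; rewrite eq_le rnorm_ge0 andbT.
apply/ler_addgt0Pl => e e0; rewrite addr0.
have k1 : 0 < `|k| + 1 by rewrite ltr_wpDl.
rewrite (le_trans (H (e / (`|k| + 1)) _)) ?divr_gt0//.
rewrite mulrCA ler_piMr ?(ltW e0)// ler_pdivrMr// mul1r.
by rewrite (le_trans (ler_norm k))// lerDl.
Qed.

End rnorm.

Section bounded_linear.
Variables (R : realType) (H : hilbert R).

Lemma bounded_opP (T : H -> H) (k : R) : linear T ->
  (forall h, rnorm (T h) <= k * rnorm h) -> bounded_op T.
Proof.
move=> lT Tk; split=> //.
pose f : {linear H -> H} := HB.pack T (GRing.isLinear.Build _ _ _ _ _ lT).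
suff : continuous f by [].
apply/linear_bounded_continuous/linear_boundedP.
exists k%:C; split; first by rewrite complex_real.
move=> r kr h; rewrite (le_trans (_ : _ <= (k * rnorm h)%:C))//.
  by rewrite rnormE lecR Tk.
by rewrite rmorphM (rnormE h) ler_wpM2r ?ler0c ?rnorm_ge0// ltW.
Qed.

End bounded_linear.

Section l2_val.
Variables (R : realType) (I : choiceType).

Lemma l2_val_sum (J : Type) (r : seq J) (F : J -> @l2 R I) i :
  val (\sum_(j <- r) F j) i = \sum_(j <- r) val (F j) i.
Proof. by rewrite raddf_sum fct_sumE. Qed.

End l2_val.

(** At the point [p i] the i-th operator is the identity and the others vanish: the
matrix coefficient there recovers the i-th coordinate of an element of the span, in
a way which is continuous for the operator norm. *)
Section wspan.
Variables (R : realType) (I : choiceType) (n : nat).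
Variables (c : 'I_n -> I -> R[i]) (s : 'I_n -> I -> I) (p : 'I_n -> I).
Hypotheses (c1 : forall k i, sqmod (c k i) <= 1) (s_inj : forall k, injective (s k)).
Hypotheses (cp : forall k i, c k (p i) = (k == i)%:R) (sp : forall i, s i (p i) = p i).
Let H := l2_hilbert R I.

Definition wgen (k : 'I_n) : H -> H := wcomp (c1 k) (@s_inj k).

Definition wop (x : 'rV[R[i]]_n) (h : H) : H := \sum_k x 0 k *: wgen k h.

Lemma wgen_linear k : linear (wgen k).
Proof. exact: wcomp_is_linear. Qed.

Lemma wop_linear x : linear (wop x).
Proof.
move=> a g h; rewrite /wop scaler_sumr -big_split/=; apply: eq_bigr => k _.
by rewrite wgen_linear scalerDr !scalerA mulrC.
Qed.

Lemma wopD (a : R[i]) x y h : wop (a *: x + y) h = a *: wop x h + wop y h.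
Proof.
rewrite /wop scaler_sumr -big_split/=; apply: eq_bigr => k _.
by rewrite !mxE scalerDl scalerA.
Qed.

Lemma rnorm_wgen k h : rnorm (wgen k h) <= rnorm h.
Proof. exact: rnorm_wcomp_le. Qed.

Lemma rnorm_wop_le x h :
  rnorm (wop x h) <= (\sum_k Num.sqrt (sqmod (x 0 k))) * rnorm h.
Proof.
rewrite (le_trans (rnorm_sum _ _))// mulr_suml ler_sum// => k _.
by rewrite rnormZc ler_wpM2l ?sqrtr_ge0// rnorm_wgen.
Qed.

Lemma wop_coef x i : val (wop x (l2_delta R (p i))) (p i) = x 0 i.
Proof.
rewrite /wop l2_val_sum (bigD1 i)//= big1 ?addr0.
  by rewrite fctE /GRing.scale/= cp eqxx sp eqxx !mulr1.
by move=> k /negbTE ki; rewrite fctE /GRing.scale/= cp ki mul0r mulr0.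
Qed.

Definition wset : set (H -> H) := range wop.

Lemma wset_bounded : wset `<=` @bounded_op R H.
Proof.
move=> _ [x _ <-].
exact: bounded_opP (@wop_linear x) (rnorm_wop_le x).
Qed.

Lemma wset_submod : submod_closed (mem wset).
Proof.
split=> [|a f g].
  rewrite inE; exists 0 => //; apply/funext => h.
  by rewrite /wop big1// => k _; rewrite mxE scale0r.
rewrite !inE => -[x _ <-] [y _ <-]; exists (a *: x + y) => //.
by apply/funext => h; rewrite wopD.
Qed.

(** The coordinates of a limit T must be its matrix coefficients at the points [p i];
they are e-close to those of any e-approximation, so the corresponding element of
the span is (1 + n) e close to T. *)
Lemma wset_closed (T : H -> H) : bounded_op T ->
  (forall e : R, 0 < e ->
     exists2 S, wset S & (opnorm (T \- S)%R < e%:E)%E) -> wset T.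
Proof.
move=> [lT _] apx.
have T0 : T 0 = 0 by have := lT (-1) 0 0; rewrite scaler0 addr0 scaleN1r addNr.
have TZ a h : T (a *: h) = a *: T h by have := lT a h 0; rewrite T0 !addr0.
pose x : 'rV[R[i]]_n := \row_i val (T (l2_delta R (p i))) (p i).
exists x => //; apply/funext => h; apply/esym.
have small h' : rnorm h' <= 1 -> T h' = wop x h'.
  move=> h1; apply/eqP; rewrite -subr_eq0; apply/eqP.
  apply: (@rnorm_small0 _ _ _ (1 + n%:R)) => e e0.
  have [_ [y _ <-] Te] := apx e e0.
  have Tye g : rnorm g <= 1 -> rnorm (T g - wop y g) <= e.
    move=> g1; rewrite ltW// -lte_fin; apply: le_lt_trans Te.
    by apply: ereal_sup_ubound; exists g.
  have xy i : Num.sqrt (sqmod ((y - x) 0 i)) <= e.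
    have d1 : rnorm (l2_delta R (p i) : H) <= 1.
      by rewrite (l2_rnorm (l2_delta R (p i))) norm2_delta sqrtr1.
    apply: le_trans (Tye _ d1).
    rewrite (l2_rnorm (T _ - wop y _)) ler_wsqrtr// -sqmodN.
    apply: le_trans (sqmod_le_norm2 _ (p i)).
    by rewrite !mxE l2_valD -[val (- _) _]/(- val _ _) wop_coef opprB.
  rewrite (_ : T h' - wop x h' = (T h' - wop y h') + wop (y - x) h'); last first.
    have := wopD (-1) x y h'; rewrite scaleN1r addrC => ->.
    by rewrite scaleN1r addrA (addrAC (T h' - _)) subrK.
  have A := rnormD (T h' - wop y h') (wop (y - x) h').
  have B := Tye _ h1.
  have C : rnorm (wop (y - x) h') <= n%:R * e.
    apply: le_trans (rnorm_wop_le (y - x) h') _.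
    rewrite -[n%:R * e]mulr1; apply: ler_pM; [|exact: rnorm_ge0| |exact: h1].
      by rewrite sumr_ge0// => i _; rewrite sqrtr_ge0.
    apply: (@le_trans _ _ (\sum_(k < n) e)); first by apply: ler_sum => i _; exact: xy.
    by rewrite sumr_const card_ord mulr_natl.
  apply: le_trans A _.
  by rewrite mulrDl mul1r; exact: lerD B C.
have [h0|h0] := eqVneq (rnorm h) 0.
  by rewrite (rnorm_eq0 h0); apply: small; rewrite rnorm0.
have h1 : h = (rnorm h)%:C *: ((rnorm h)^-1%:C *: h).
  by rewrite scalerA -rmorphM mulfV// scale1r.
have wopZ a g : wop x (a *: g) = a *: wop x g.
  have z : wop x 0 = 0.
    by have := @wop_linear x (-1) 0 0; rewrite scaler0 addr0 scaleN1r addNr.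
  by have := @wop_linear x a g 0; rewrite z !addr0.
rewrite h1 TZ wopZ small// rnormZ ?invr_ge0 ?rnorm_ge0// mulVf//.
Qed.

Definition wspan : opspace R := @OpSpace R H wset wset_bounded wset_submod wset_closed.

Lemma wspan_subproof x : wop x \in @os_pred R wspan.
Proof. by rewrite inE; exists x. Qed.

Definition wspan_map (x : 'rV[R[i]]_n) : wspan :=
  exist (fun T => T \in @os_pred R wspan) _ (wspan_subproof x).

Lemma wspan_map_linear : linear wspan_map.
Proof.
by move=> a x y; apply/val_inj/funext => h /=; rewrite wopD.
Qed.

HB.instance Definition _ := GRing.isLinear.Build _ _ _ _ wspan_map wspan_map_linear.

Lemma wspan_map_bij : bijective wspan_map.
Proof.
exists (fun T => \row_i val (val T (l2_delta R (p i) : H) : @l2 R I) (p i)).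
  by move=> x; apply/rowP => i; rewrite mxE wop_coef.
move=> [T TE]; apply: val_inj => /=; have [x _ xT] := set_mem TE.
by rewrite -xT; congr wop; apply/rowP => i; rewrite mxE wop_coef.
Qed.

End wspan.

(** * Matrices with monomial entries *)

Section l2norm_theory.
Variables (R : realType) (H : hilbert R) (m : nat).
Implicit Types g h : 'I_m -> H.

Lemma l2norm_sq h : l2norm h ^+ 2 = \sum_i rnorm (h i) ^+ 2.
Proof. by rewrite sqr_sqrtr// sumr_ge0// => i _; rewrite sqr_ge0. Qed.

Lemma l2normD g h : l2norm (fun i => g i + h i) <= l2norm g + l2norm h.
Proof.
apply: sqrt_le_add; rewrite ?l2norm_ge0// => t t0.
rewrite !l2norm_sq !mulr_sumr -big_split/=; apply: ler_sum => i _.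
have := rnormD (g i) (h i); have := rnorm_ge0 (g i + h i).
have := rnorm_ge0 (g i); have := rnorm_ge0 (h i).
move: (rnorm _) (rnorm (g i)) (rnorm (h i)) => a b c b0 c0 a0 abc.
apply: (@le_trans _ _ ((b + c) ^+ 2)); first by rewrite ler_sqr ?nnegrE// addr_ge0.
rewrite -subr_ge0 (_ : _ - _ = t^-1 * (t * b - c) ^+ 2).
  by rewrite mulr_ge0 ?sqr_ge0// invr_ge0 ltW.
by field; rewrite gt_eqF.
Qed.

Lemma l2norm_sum (J : Type) (r : seq J) (F : J -> 'I_m -> H) :
  l2norm (fun i => \sum_(j <- r) F j i) <= \sum_(j <- r) l2norm (F j).
Proof.
elim: r => [|j r IHr].
  by rewrite big_nil l2norm_eq0// => i; rewrite big_nil.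
rewrite big_cons (_ : (fun _ => _) = fun i => F j i + \sum_(k <- r) F k i); last first.
  by apply/funext => i; rewrite big_cons.
by rewrite (le_trans (l2normD _ _))// lerD2l.
Qed.

Lemma l2norm_scale_le (k : R) g h (s : 'I_m -> 'I_m) : 0 <= k -> injective s ->
  (forall i, rnorm (g i) <= k * rnorm (h (s i))) -> l2norm g <= k * l2norm h.
Proof.
move=> k0 si gh.
rewrite -(ger0_norm k0) -sqrtr_sqr -sqrtrM ?sqr_ge0// ler_wsqrtr//.
rewrite [X in _ * X](reindex_inj si) mulr_sumr; apply: ler_sum => i _.
by rewrite -exprMn ler_sqr ?nnegrE ?mulr_ge0 ?rnorm_ge0//; exact: gh.
Qed.

End l2norm_theory.

Section monomial.
Variables (R : realType) (n d : nat).
Variables (b : 'I_n -> 'I_d -> R[i]) (s : 'I_n -> 'I_d -> 'I_d).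

(** For each generator the coefficients form a matrix with at most one nonzero entry
in each row; a generator then enters the amplified operator through a permutation of
the components, and the size [d] does not appear in the estimates. *)
Definition monomial : 'M['rV[R[i]]_n]_d :=
  \matrix_(i, j) \row_k (b k i * (j == s k i)%:R).

Lemma mxapply_monomial (E : opspace R) (g : {linear 'rV[R[i]]_n -> E}) h i :
  mxapply (map_mx g monomial) h i =
  \sum_k b k i *: val (g (delta_mx 0 k)) (h (s k i)).
Proof.
have E1 j : val (g (monomial i j)) (h j) =
    \sum_k (b k i * (j == s k i)%:R) *: val (g (delta_mx 0 k)) (h j).
  rewrite [monomial i j]row_sum_delta !raddf_sum fct_sumE/=.
  by apply: eq_bigr => k _; rewrite linearZ/= fctE !mxE.
rewrite /mxapply; under eq_bigr do rewrite mxE E1.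
rewrite exchange_big/=; apply: eq_bigr => k _.
rewrite (bigD1 (s k i))//= big1 ?addr0 ?eqxx ?mulr1// => j /negbTE ->.
by rewrite mulr0 scale0r.
Qed.

Hypotheses (b1 : forall k i, sqmod (b k i) <= 1) (s_inj : forall k, injective (s k)).

(** Each of the n generators contributes an operator on the Hilbert sum which permutes
the components and applies to them operators of norm at most e. *)
Lemma mxnorm_monomial_perturb (E : opspace R) (g g' : {linear 'rV[R[i]]_n -> E}) (e : R) :
  0 <= e ->
  (forall k h, rnorm (val (g (delta_mx 0 k)) h - val (g' (delta_mx 0 k)) h) <= e * rnorm h) ->
  (mxnorm (map_mx g monomial) <= mxnorm (map_mx g' monomial) + (n%:R * e)%:E)%E.
Proof.
move=> e0 gg'; rewrite mxnormE; apply: ge_ereal_sup => _ [h h1 <-].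
pose D k i := b k i *: (val (g (delta_mx 0 k)) (h (s k i)) - val (g' (delta_mx 0 k)) (h (s k i))).
have -> : mxapply (map_mx g monomial) h =
    fun i => mxapply (map_mx g' monomial) h i + \sum_k D k i.
  apply/funext => i; rewrite !mxapply_monomial -big_split/=; apply: eq_bigr => k _.
  by rewrite /D scalerBr addrC subrK.
apply: (@le_trans _ _ ((l2norm (mxapply (map_mx g' monomial) h))%:E + (n%:R * e)%:E)%E).
  rewrite -EFinD lee_fin (le_trans (l2normD _ _))// lerD2l.
  rewrite (le_trans (l2norm_sum _ _))//.
  apply: (@le_trans _ _ (\sum_(k < n) e)); last by rewrite sumr_const card_ord mulr_natl.
  apply: ler_sum => k _.
  apply: (@le_trans _ _ (e * l2norm h)); last by rewrite ler_piMr.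
  apply: (l2norm_scale_le e0 (@s_inj k)) => i.
  rewrite rnormZc; apply: le_trans (gg' k _).
  rewrite ler_piMl ?rnorm_ge0//.
  by rewrite -sqrtr1 ler_wsqrtr.
by rewrite leeD2r// mxapply_le_mxnorm.
Qed.

End monomial.

(** * Blocks of torsion points *)

Section fibers.
Variable R : realType.

Lemma esum_finType (T : finType) (a : T -> R) : (forall t, 0 <= a t) ->
  (\esum_(t in [set: T]) (a t)%:E = (\sum_t a t)%:E)%E.
Proof.
move=> a0; rewrite esum_fset; [|exact: finite_finset|by move=> t _; rewrite lee_fin].
rewrite -sumEFin (fsbig_seq _ _ (index_enum_uniq T)).
rewrite (_ : [set` index_enum T] = setT)//.
by apply/seteqP; split => t //= _; rewrite mem_index_enum.
Qed.

Lemma esum_finimage (T : finType) (I : choiceType) (e : T -> I) (a : I -> R) :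
  injective e -> (forall i, 0 <= a i) ->
  (\esum_(i in e @` setT) (a i)%:E = (\sum_t a (e t))%:E)%E.
Proof.
move=> ei a0; rewrite (esum_image setT e (fun i => (a i)%:E)).
  exact: esum_finType.
by move=> s t _ _; exact: ei.
Qed.

(** The fibers of [p] are the blocks of an orthogonal decomposition which all the
operators under consideration preserve. *)
Lemma le_esum_fibers (I : choiceType) (p : I -> nat) (a b : I -> \bar R) :
  (forall i, 0 <= a i)%E -> (forall i, 0 <= b i)%E ->
  (forall m, \esum_(i in p @^-1` [set m]) a i <= \esum_(i in p @^-1` [set m]) b i)%E ->
  (\esum_(i in setT) a i <= \esum_(i in setT) b i)%E.
Proof.
move=> a0 b0 ab.
have E : [set: I] = \bigcup_(m in setT) p @^-1` [set m].
  by apply/seteqP; split => // i _; exists (p i).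
have tp : trivIset setT (fun m => p @^-1` [set m]).
  by move=> m m' _ _ [i [/= -> ->]].
rewrite E !esum_bigcupT//; apply: le_esum => m _; exact: ab.
Qed.

Lemma sum_norm2_le (I : choiceType) (p : I -> nat) (J : finType)
    (g h : J -> @l2 R I) (c : R) : 0 <= c ->
  (forall m, \esum_(i in p @^-1` [set m]) (\sum_j sqmod (val (g j) i))%:E <=
             \esum_(i in p @^-1` [set m]) (c * \sum_j sqmod (val (h j) i))%:E)%E ->
  \sum_j norm2 (g j) <= c * \sum_j norm2 (h j).
Proof.
move=> c0 gh.
have E (f : J -> @l2 R I) : ((\sum_j norm2 (f j))%:E =
    \esum_(i in setT) (\sum_j sqmod (val (f j) i))%:E)%E.
  rewrite -sumEFin; under eq_bigr do rewrite -norm2E.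
  rewrite -esum_sum; first by apply: eq_esum => i _; rewrite sumEFin.
  by move=> *; rewrite lee_fin sqmod_ge0.
have s0 (f : J -> @l2 R I) i : 0 <= \sum_j sqmod (val (f j) i).
  by rewrite sumr_ge0// => j _; rewrite sqmod_ge0.
rewrite -lee_fin EFinM !E -esumZ//.
apply: (@le_esum_fibers _ p) => // i; rewrite lee_fin ?mulr_ge0//.
Qed.

End fibers.

Lemma sum_ord3 (V : zmodType) n (F : nat -> V) : (2 < n)%N ->
  (forall i, (2 < i)%N -> F i = 0) -> \sum_(i < n) F i = F 0%N + F 1%N + F 2%N.
Proof.
case: n => [|[|[|n]]]// _ F0; rewrite !big_ord_recl big1 ?addr0 ?addrA//.
by move=> i _; exact: F0.
Qed.

Definition block_index n : choiceType := ('I_n + {N : nat & torus N})%type.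

Section family.
Variables (R : realType) (n : nat).

(** The generators of index larger than 2 vanish on the blocks of torsion points, see
[phase]; their permutation there is arbitrary. *)
Definition shear (i : nat) N : torus N -> torus N :=
  match i with 1 => @shearL N | 2 => @shearU N | _ => id end.

Definition shear_inv (i : nat) N : torus N -> torus N :=
  match i with 1 => @shearLi N | 2 => @shearUi N | _ => id end.

Lemma shearK i N : cancel (@shear i N) (@shear_inv i N).
Proof. by case: i => [|[|[|i]]] k //=; [exact: shearLK|exact: shearUK]. Qed.

Definition phase (i : nat) N (k : torus N) : R[i] :=
  match i with 0 | 2 => 1 | 1 => turn (angle R k.1) | _ => 0 end.

Lemma sqmod_phase_le1 i N (k : torus N) : sqmod (phase i k) <= 1.
Proof.
by case: i => [|[|[|i]]] /=; rewrite ?sqmod1 ?sqmod_turn// sqmod0.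
Qed.

Lemma sqmod_bool_le1 (b : bool) : sqmod (b%:R : R[i]) <= 1.
Proof. by case: b; rewrite ?sqmod1 ?sqmod0. Qed.

Definition move_index (i : 'I_n) (j : block_index n) : block_index n :=
  match j with
  | inl l => inl l
  | inr u => inr (existT (fun N => torus N : Type) (projT1 u) (shear i (projT2 u)))
  end.

Definition weight (W : nat -> bool) (i : 'I_n) (j : block_index n) : R[i] :=
  match j with
  | inl l => (i == l)%:R
  | inr u => (W (projT1 u) && primitive (projT2 u))%:R * phase i (projT2 u)
  end.

Lemma move_index_inj i : injective (move_index i).
Proof.
apply: (@can_inj _ _ _ (fun j => match j with
  | inl l => inl l
  | inr u => inr (existT (fun N => torus N : Type) (projT1 u) (shear_inv i (projT2 u)))
  end)).
by move=> [l|[N k]] //=; rewrite shearK.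
Qed.

Lemma sqmod_weight_le1 W i j : sqmod (weight W i j) <= 1.
Proof.
case: j => [l|[N k]] /=; first exact: sqmod_bool_le1.
by rewrite sqmodM mulr_ile1 ?sqmod_ge0 ?sqmod_bool_le1 ?sqmod_phase_le1.
Qed.

Definition block_rank (j : block_index n) : nat :=
  match j with inl _ => 0 | inr u => (projT1 u).+1 end.

Definition in_block N (k : torus N) : block_index n :=
  inr (existT (fun N => torus N : Type) N k).

Lemma block_rank0 : block_rank @^-1` [set 0%N] = inl @` setT.
Proof.
by apply/seteqP; split=> [[l _|[N k]]|_ [l _ <-]] //; exists l.
Qed.

Lemma block_rankS N : block_rank @^-1` [set N.+1] = @in_block N @` setT.
Proof.
apply/seteqP; split=> [[l|[M k]] //= [MN]|_ [l _ <-]] //.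
by subst M; exists k.
Qed.

Lemma in_block_inj N : injective (@in_block N).
Proof.
move=> k l [] kl.
by have := Eqdep_dec.inj_pair2_eq_dec _ (@eq_comparable nat)
  (fun N => torus N : Type) _ _ _ kl.
Qed.

(** On the diagonal block a single generator acts. On the block of index M, either
M is not in W and every generator vanishes, or M <> N and the inequality is
[block_bound] for the pairs of points. *)
Lemma block_ineq (W : nat -> bool) N (hh : torus N -> @l2 R (block_index n)) m :
  (2 < n)%N -> ~~ W N ->
  (\esum_(j in block_rank @^-1` [set m])
     (\sum_(k : torus N) sqmod (\sum_(i < n) conjc (phase i k) * (primitive k)%:R *
        (weight W i j * val (hh (shear i k)) (move_index i j))))%:E <=
   \esum_(j in block_rank @^-1` [set m])
     ((9 - 1 / 188) * \sum_k sqmod (val (hh k) j))%:E)%E.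
Proof.
move=> n2 WN.
have s0 (T : finType) (f : T -> R[i]) : 0 <= \sum_t sqmod (f t).
  by rewrite sumr_ge0// => t _; rewrite sqmod_ge0.
have c0 : 0 <= 9 - 1 / 188 :> R by lra.
case: m => [|M].
  have inlI : injective (@inl 'I_n {N : nat & torus N}) by move=> ? ? [].
  rewrite block_rank0 !esum_finimage//; last by move=> j; rewrite mulr_ge0.
  rewrite lee_fin; apply: ler_sum => l _.
  apply: (@le_trans _ _ (\sum_k sqmod (val (hh (shear l k)) (inl l)))).
    apply: ler_sum => k _; rewrite (bigD1 l)//= big1 ?addr0; last first.
      by move=> i /negbTE il; rewrite il mul0r mulr0.
    rewrite eqxx mul1r !sqmodM sqmod_conj.
    rewrite ler_piMl ?sqmod_ge0// mulr_ile1 ?sqmod_ge0 ?sqmod_bool_le1//.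
    exact: sqmod_phase_le1.
  rewrite -(reindex_inj (can_inj (@shearK l N)) (P := xpredT)
    (F := fun k => sqmod (val (hh k) (inl l)))).
  by rewrite ler_peMl//; lra.
rewrite block_rankS !esum_finimage//; do ?exact: in_block_inj; last first.
  by move=> j; rewrite mulr_ge0.
rewrite lee_fin.
case WM : (W M); last first.
  rewrite big1; first by rewrite sumr_ge0// => l _; rewrite mulr_ge0.
  move=> l _; rewrite big1// => k _; rewrite big1 ?sqmod0// => i _.
  by rewrite /= WM mul0r mul0r mulr0.
have NM : N <> M by move=> NM; rewrite NM WM in WN.
rewrite -mulr_sumr exchange_big/= [X in _ * X]exchange_big/= !pair_big/=.
apply: le_trans (block_bound NM (fun v => val (hh v.1) (in_block v.2))).
apply: ler_sum => -[k l] _; rewrite /= WM/=.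
rewrite (sum_ord3 (F := fun i => conjc (phase i k) * (primitive k)%:R *
  ((primitive l)%:R * phase i l * val (hh (shear i k)) (in_block (shear i l)))))//; last first.
  by case=> [|[|[|i]]] // _ /=; rewrite mulr0 mul0r mulr0.
have one_conj : conjc (1 : R[i]) = 1 by apply/eqP; rewrite eq_complex/= oppr0 !eqxx.
have p0 M' (a : torus M') : phase 0 a = 1 by [].
have p1 M' (a : torus M') : phase 1 a = turn (angle R a.1) by [].
have p2 M' (a : torus M') : phase 2 a = 1 by [].
rewrite [turn (_ - _)]turnD turnN !p0 !p1 !p2 one_conj.
rewrite -[shear 0 k]/k -[shear 0 l]/l -![shear 1 _]/(shearL _) -![shear 2 _]/(shearU _).
rewrite le_eqVlt; apply/orP; left; apply/eqP; congr sqmod.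
rewrite -mulnb natrM; move: ((primitive k)%:R : R[i]) ((primitive l)%:R : R[i]) => a b.
have valE (f : @l2 R (block_index n)) j : val f j = sval f j by [].
by rewrite !valE; ring.
Qed.

End family.

(** * Test matrices telling the spaces apart *)

Lemma wop_delta (R : realType) (I : choiceType) n (c : 'I_n -> I -> R[i]) s
    (c1 : forall k i, sqmod (c k i) <= 1) (s_inj : forall k, injective (s k)) k h :
  wop c1 s_inj (delta_mx 0 k) h = wgen c1 s_inj k h.
Proof.
rewrite /wop (bigD1 k)//= mxE !eqxx scale1r big1 ?addr0// => l /negbTE lk.
by rewrite mxE lk andbF scale0r.
Qed.

Section separation.
Variables (R : realType) (n : nat).
Hypothesis n2 : (2 < n)%N.

Lemma weight_inl W (k i : 'I_n) : weight R W k (inl i) = (k == i)%:R.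
Proof. by []. Qed.

Lemma move_inl (i : 'I_n) : move_index i (inl i) = inl i.
Proof. by []. Qed.

Definition os_blocks W : opspace R :=
  wspan (@sqmod_weight_le1 R n W) (@move_index_inj n) (weight_inl W) move_inl.

Definition os_blocks_map W : {linear 'rV[R[i]]_n -> os_blocks W} :=
  @wspan_map R (block_index n) n _ _ _ (@sqmod_weight_le1 R n W) (@move_index_inj n)
    (weight_inl W) move_inl.

Lemma os_blocks_map_bij W : bijective (os_blocks_map W).
Proof. exact: wspan_map_bij. Qed.

Definition test_coef N (i : 'I_n) (a : 'I_#|torus N|) : R[i] :=
  conjc (phase R i (enum_val a)) * (primitive (enum_val a))%:R.

Definition test_move N (i : 'I_n) (a : 'I_#|torus N|) : 'I_#|torus N| :=
  enum_rank (shear i (enum_val a)).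

Definition test N := monomial (@test_coef N) (@test_move N).

Lemma sqmod_test_coef N i a : sqmod (@test_coef N i a) <= 1.
Proof.
by rewrite sqmodM sqmod_conj mulr_ile1 ?sqmod_ge0 ?sqmod_bool_le1 ?sqmod_phase_le1.
Qed.

Lemma test_move_inj N i : injective (@test_move N i).
Proof.
by move=> a b /enum_rank_inj/(can_inj (@shearK i N))/enum_val_inj.
Qed.

Lemma mxapply_test W N h a :
  mxapply (map_mx (os_blocks_map W) (test N)) h a =
  \sum_i test_coef i a *:
    wgen (@sqmod_weight_le1 R n W) (@move_index_inj n) i (h (test_move i a)).
Proof.
rewrite mxapply_monomial; apply: eq_bigr => i _; congr (_ *: _).
exact: wop_delta.
Qed.

Lemma sum_rank N (F : 'I_#|torus N| -> R) :
  \sum_a F a = \sum_k F (enum_rank k).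
Proof. by rewrite (reindex (@enum_rank (torus N)))//; exact/onW_bij/enum_rank_bij. Qed.

Lemma l2norm_l2 (I : choiceType) m (h : 'I_m -> l2_hilbert R I) :
  l2norm h = Num.sqrt (\sum_i norm2 (h i : l2 R I)).
Proof. by congr Num.sqrt; apply: eq_bigr => i _; rewrite -l2_rnorm_sq. Qed.

Let valZ W (a : R[i]) (i : 'I_n) (h : l2_hilbert R (block_index n)) j :
  val (a *: wgen (@sqmod_weight_le1 R n W) (@move_index_inj n) i h : l2 R _) j =
  a * (weight R W i j * val (h : l2 R _) (move_index i j)).
Proof. by []. Qed.

Lemma mxnorm_test_le (W : nat -> bool) N : ~~ W N ->
  (mxnorm (map_mx (os_blocks_map W) (test N)) <= (Num.sqrt (9 - 1 / 188))%:E)%E.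
Proof.
move=> WN; rewrite mxnormE; apply: ge_ereal_sup => _ [h h1 <-].
have c0 : 0 <= 9 - 1 / 188 :> R by lra.
rewrite lee_fin -[leRHS]mulr1.
apply: (@le_trans _ _ (Num.sqrt (9 - 1 / 188) * l2norm h)); last first.
  by rewrite ler_wpM2l ?sqrtr_ge0.
rewrite !l2norm_l2 -sqrtrM// ler_wsqrtr// !sum_rank.
pose hh (k : torus N) : l2 R (block_index n) := h (enum_rank k).
apply: (sum_norm2_le (p := @block_rank n) c0 (h := hh)) => m.
apply: le_trans (block_ineq hh m n2 WN).
rewrite le_eqVlt; apply/orP; left; apply/eqP; apply: eq_esum => j _.
congr (_%:E); apply: eq_bigr => k _; congr sqmod.
rewrite mxapply_test l2_val_sum; apply: eq_bigr => i _.
by rewrite valZ /test_coef /test_move enum_rankK.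
Qed.

(** The norm 3 is reached at the normalized sum of the e_k (x) e_k for k primitive,
which all the three operators conj(U_i) (x) U_i fix. *)
Lemma mxnorm_test_ge (W : nat -> bool) N : W N ->
  (3%:E <= mxnorm (map_mx (os_blocks_map W) (test N)))%E.
Proof.
move=> WN; pose P : R := \sum_(k : torus N) (primitive k)%:R.
have P0 : 0 < P.
  rewrite /P (bigD1 (1, 0))//= primitive_e1; apply: ltr_pwDl; first exact: ltr01.
  by apply: sumr_ge0 => k _; exact: ler0n.
pose r := (Num.sqrt P)^-1.
pose h (a : 'I_#|torus N|) : l2_hilbert R (block_index n) :=
  (r * (primitive (enum_val a))%:R)%:C *: l2_delta R (in_block n (enum_val a)).
have r2 : r ^+ 2 = P^-1 by rewrite /r exprVn sqr_sqrtr// ltW.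
have prim2 N' (k : torus N') : ((primitive k)%:R : R) ^+ 2 = (primitive k)%:R.
  by case: (primitive k); rewrite ?expr1n// expr0n.
have h1 : l2norm h <= 1.
  rewrite l2norm_l2 sum_rank (eq_bigr (fun k => P^-1 * (primitive k)%:R)); last first.
    move=> k _; rewrite /h norm2Z norm2_delta mulr1 /sqmod/= expr0n addr0 enum_rankK.
    by rewrite exprMn r2 prim2.
  by rewrite -mulr_sumr mulVf ?gt_eqF// sqrtr1.
apply: le_trans _ (mxapply_le_mxnorm (map_mx (os_blocks_map W) (test N)) h1).
rewrite lee_fin l2norm_l2 -[leLHS]ger0_norm// -sqrtr_sqr ler_wsqrtr//.
rewrite sum_rank.
have E (k : torus N) : val (mxapply (map_mx (os_blocks_map W) (test N)) h
    (enum_rank k) : l2 R _) (in_block n k) = (3 * r * (primitive k)%:R)%:C.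
  rewrite mxapply_test l2_val_sum.
  have prim_shear i : primitive (shear i k) = primitive k.
    by case: i => [|[|[|i]]] //=; rewrite ?primitive_shearL ?primitive_shearU.
  pose F i : R[i] := conjc (phase R i k) * (primitive k)%:R * ((primitive k)%:R *
    phase R i k * (r * (primitive k)%:R)%:C).
  rewrite (eq_bigr (fun i : 'I_n => F i)); last first.
    move=> i _; rewrite valZ /test_coef /test_move enum_rankK /h enum_rankK.
    by rewrite l2_valZ /= WN eqxx mulr1 prim_shear.
  rewrite sum_ord3//; last by case=> [|[|[|i]]] // _; rewrite /F/= mulr0 mul0r mulr0.
  have F1 i : (i < 3)%N -> F i = (r * (primitive k)%:R)%:C.
    have one : conjc (phase R i k) * phase R i k = (sqmod (phase R i k))%:C.
      by rewrite mulrC; case: (phase R i k) => a b; apply/eqP; rewrite eq_complex/= /sqmod/=;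
        apply/andP; split; apply/eqP; ring.
    move=> i3; rewrite (_ : F i = (conjc (phase R i k) * phase R i k) *
      ((primitive k)%:R * (primitive k)%:R * (r * (primitive k)%:R)%:C)); last first.
      by rewrite /F; ring.
    rewrite one (_ : sqmod _ = 1); last first.
      by move: i3; case: i {one} => [|[|[|i]]] //= _; rewrite ?sqmod1 ?sqmod_turn.
    by case: (primitive k); rewrite ?mulr1 ?mulr0// !mulr1n !mul1r.
  by rewrite !F1// -!rmorphD; congr (_%:C); ring.
have S : \sum_(k : torus N) sqmod (3 * r * (primitive k)%:R)%:C = 3 ^+ 2.
  rewrite (eq_bigr (fun k => 3 ^+ 2 * r ^+ 2 * (primitive k)%:R)); last first.
    by move=> k _; rewrite /sqmod/= expr0n addr0 !exprMn prim2.
  by rewrite -mulr_sumr r2 -mulrA mulVf ?mulr1// gt_eqF.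
rewrite -S; apply: ler_sum => k _; rewrite -E.
exact: sqmod_le_norm2.
Qed.

End separation.

(** * Comparison of two spaces up to a small error *)

Lemma cantor_bool (T : countType) (f : (nat -> bool) -> T) : ~ injective f.
Proof.
move=> fI; pose D (W : nat -> bool) k := pickle (f W) = k /\ W k = false.
pose W k := `[< exists W', D W' k >].
case WW : (W (pickle (f W))).
  move: (WW) => /asboolP[W' [/(pcan_inj pickleK)/fI E]].
  by rewrite E WW.
by move: (WW) => /asboolP; apply; exists W.
Qed.

Section normalization.
Variables (R : realType) (E F : opspace R).

(** In the extended reals a product may be finite because one of the factors is 0
and the other is infinite; this rules it out. *)
Lemma cbnorm_neq0 (u : {linear E -> F}) (x : E) : injective u -> x != 0 ->
  cbnorm u != 0%E.
Proof.
move=> uI x0; apply/eqP => u0.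
have := mxnorm_map_le u (\matrix_(i < 1, j < 1) x); rewrite u0 mul0e => ux.
have /mxnorm_eq0 /matrixP/(_ ord0 ord0) : mxnorm (map_mx u (\matrix_(i < 1, j < 1) x)) = 0%E.
  by apply/eqP; rewrite eq_le ux mxnorm_ge0.
by rewrite !mxE -(linear0 u) => /uI /eqP; rewrite (negbTE x0).
Qed.

(** Rescale the isomorphism by its own completely bounded norm. *)
Lemma dcb_lt_normalize (q : R) (x : E) : x != 0 -> (dcb E F < q%:E)%E ->
  exists w : {linear E -> F}, forall m (z : 'M[E]_m),
    (mxnorm (map_mx w z) <= mxnorm z)%E /\
    (mxnorm z <= q%:E * mxnorm (map_mx w z))%E.
Proof.
move=> x0 /ereal_inf_lt[_ [u [v [uv vu ->]]] uvq].
have u0 := cbnorm_neq0 (can_inj uv) x0.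
have v0 : cbnorm v != 0%E.
  apply/eqP => v0; have := mxnorm_map_le v (\matrix_(i < 1, j < 1) u x).
  rewrite v0 mul0e => vx.
  have /mxnorm_eq0/matrixP/(_ ord0 ord0) :
      mxnorm (map_mx v (\matrix_(i < 1, j < 1) u x)) = 0%E.
    by apply/eqP; rewrite eq_le vx mxnorm_ge0.
  by rewrite !mxE uv => /eqP; rewrite (negbTE x0).
have u1 : (0 < cbnorm u)%E by rewrite lt_neqAle eq_sym u0 cbnorm_ge0.
have v1 : (0 < cbnorm v)%E by rewrite lt_neqAle eq_sym v0 cbnorm_ge0.
have := mxnorm_map_le v; have := mxnorm_map_le u.
move: uvq u1 v1; case: (cbnorm u) => [a| |] //; last first.
  by move=> /[swap] _ /[swap] v1; rewrite gt0_mulye// ltNge leey.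
case: (cbnorm v) => [b| |] //; last first.
  by move=> /[swap] a0 /[swap] v1; rewrite gt0_muley// ltNge leey.
rewrite !lte_fin => abq a0 b0 ua vb.
pose w : {linear E -> F} := a^-1%:C \*: u.
exists w => m z.
have a1 : 0 <= a^-1 by rewrite invr_ge0 ltW.
have wE : map_mx w z = map_mx ( *:%R a^-1%:C) (map_mx u z).
  by apply/matrixP => i j; rewrite !mxE.
have uE : map_mx u z = map_mx ( *:%R a%:C) (map_mx w z).
  by apply/matrixP => i j; rewrite !mxE /= scalerA -rmorphM mulfV ?gt_eqF// scale1r.
split.
  rewrite wE (le_trans (mxnormZ_le _ a1))//.
  apply: (@le_trans _ _ (a^-1%:E * (a%:E * mxnorm z))%E); first by rewrite lee_wpmul2l.
  by rewrite muleA -EFinM mulVf ?gt_eqF// mul1e.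
have zE : z = map_mx v (map_mx u z) by rewrite -map_mx_comp map_mx_id.
rewrite {1}zE (le_trans (vb _ _))// uE.
apply: (@le_trans _ _ (b%:E * (a%:E * mxnorm (map_mx w z)))%E).
  by rewrite lee_wpmul2l ?lee_fin ?(ltW b0)// mxnormZ_le// ltW.
rewrite muleA -EFinM lee_wpmul2r ?mxnorm_ge0// lee_fin mulrC.
exact: ltW.
Qed.

End normalization.

Section rounding.
Variables (R : realType) (n : nat).
Hypothesis n2 : (2 < n)%N.

Definition gap_norm : R := Num.sqrt (9 - 1 / 188).

Lemma gap_norm_lt3 : gap_norm < 3.
Proof.
rewrite -[ltRHS]ger0_norm// -sqrtr_sqr ltr_sqrt ?exprn_gt0//; lra.
Qed.

Lemma gap_norm_ge0 : 0 <= gap_norm.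
Proof. exact: sqrtr_ge0. Qed.

Lemma elem_bound (F : opspace R) (T : F) : exists2 k, 0 <= k &
  forall h, rnorm (val T h) <= k * rnorm h.
Proof.
have [lT cT] := elem_bounded T.
pose f : {linear os_hilbert F -> os_hilbert F} :=
  HB.pack (val T) (GRing.isLinear.Build _ _ _ _ _ lT).
have /linear_bounded_continuous : continuous f by [].
rewrite linear_boundedP => /pinfty_ex_gt0[r r0 fr].
have rE : r = (complex.Re r)%:C by rewrite RRe_real// gtr0_real.
exists (complex.Re r) => [|h].
  by rewrite -lecR -rE ltW.
have := fr h; rewrite rE !rnormE -rmorphM lecR; exact.
Qed.

Lemma floor_close (d a b : R) : 0 < d -> Num.floor (a / d) = Num.floor (b / d) ->
  `|a - b| <= d.
Proof.
move=> d0 ab; have := floor_itv (a / d); have := floor_itv (b / d).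
rewrite ab intrD mulr1z => /andP[b1 b2] /andP[a1 a2].
have : `|a / d - b / d| <= 1 by rewrite ler_norml; apply/andP; split; lra.
by rewrite -mulrBl normrM normfV (gtr0_norm d0) ler_pdivrMr// mul1r.
Qed.

Lemma sqmod_close (d : R) (z z' : R[i]) : 0 < d ->
  Num.floor (complex.Re z / d) = Num.floor (complex.Re z' / d) ->
  Num.floor (complex.Im z / d) = Num.floor (complex.Im z' / d) ->
  Num.sqrt (sqmod (z - z')) <= 2 * d.
Proof.
move=> d0 /(floor_close d0) re /(floor_close d0) im.
have d2 : 0 <= 2 * d by rewrite mulr_ge0// ltW.
rewrite -(ger0_norm d2) -sqrtr_sqr ler_wsqrtr//.
case: z z' re im => [a b] [a' b']; rewrite /sqmod/= !ler_norml => /andP[? ?] /andP[? ?].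
nra.
Qed.

(** With [ratio] the allowed distortion and [tol] the allowed perturbation of the norms
of the test matrices, a matrix of norm at most [gap_norm] cannot be taken for one of
norm 3, see [ratio_tol]. *)
Definition tol : R := (3 - gap_norm) / 4.
Definition ratio : R := 6 / (3 + gap_norm).

Lemma tol_gt0 : 0 < tol.
Proof. by rewrite divr_gt0// subr_gt0 gap_norm_lt3. Qed.

Lemma ratio_gt1 : 1 < ratio.
Proof.
have c3 := gap_norm_lt3; have c0 := gap_norm_ge0.
by rewrite ltr_pdivlMr; lra.
Qed.

Lemma ratio_tol : ratio * (gap_norm + tol) < 3.
Proof.
have c3 := gap_norm_lt3; have c0 := gap_norm_ge0.
rewrite /ratio /tol mulrAC ltr_pdivrMr; lra.
Qed.

(** The cell of a matrix in the grid of mesh [d]. *)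
Definition code (d : R) (A : 'M[R[i]]_n) : 'M[int * int]_n :=
  \matrix_(k, j) (Num.floor (complex.Re (A k j) / d), Num.floor (complex.Im (A k j) / d)).

Lemma code_close (d : R) (A A' : 'M[R[i]]_n) k j : 0 < d -> code d A = code d A' ->
  Num.sqrt (sqmod (A k j - A' k j)) <= 2 * d.
Proof. by move=> d0 /matrixP/(_ k j); rewrite !mxE => -[]; exact: sqmod_close. Qed.

(** The mesh depends on the norms of the basis elements in F, so it is chosen after F. *)
Lemma coding_scale (F : opspace R) (g : {linear 'rV[R[i]]_n -> F}) (e : R) : 0 < e ->
  exists2 d, 0 < d & forall A A' : 'M[R[i]]_n, code d A = code d A' ->
    forall k h, rnorm (val (g (row k A)) h - val (g (row k A')) h) <= e * rnorm h.
Proof.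
move=> e0.
have /choice[K KP] : forall j : 'I_n, exists K : R, 0 <= K /\
    forall h, rnorm (val (g (delta_mx 0 j)) h) <= K * rnorm h.
  by move=> j; have [K K0 KP] := elem_bound (g (delta_mx 0 j)); exists K.
pose S := \sum_j K j.
have S0 : 0 <= S by apply: sumr_ge0 => j _; have [] := KP j.
have S1 : 0 < S + 1 by rewrite ltr_wpDl.
exists (e / (2 * (S + 1))) => [|A A' AA' k h]; first by rewrite divr_gt0// mulr_gt0.
set d := e / _ in AA'; have d0 : 0 < d by rewrite divr_gt0// mulr_gt0.
have E : val (g (row k A)) h - val (g (row k A')) h =
    \sum_j (A k j - A' k j) *: val (g (delta_mx 0 j)) h.
  have rowE (B : 'M[R[i]]_n) : val (g (row k B)) h =
      \sum_j B k j *: val (g (delta_mx 0 j)) h.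
    rewrite [row k B]row_sum_delta !raddf_sum fct_sumE/=.
    by apply: eq_bigr => j _; rewrite linearZ/= fctE !mxE.
  by rewrite !rowE -sumrB; apply: eq_bigr => j _; rewrite scalerBl.
rewrite E (le_trans (rnorm_sum _ _))//.
apply: (@le_trans _ _ (\sum_j (2 * d) * (K j * rnorm h))).
  apply: ler_sum => j _; rewrite rnormZc ler_pM ?sqrtr_ge0 ?rnorm_ge0//.
    exact: code_close.
  by have [_] := KP j.
rewrite -mulr_sumr -mulr_suml -/S mulrA ler_wpM2r ?rnorm_ge0//.
have dE : 2 * d * (S + 1) = e by rewrite /d; field; rewrite gt_eqF.
rewrite -[leRHS]dE; apply: ler_wpM2l; last by rewrite lerDl.
by rewrite mulr_ge0// ltW.
Qed.

(** The matrix [A] gives, in the basis [g], an isomorphism from [os_blocks W] to F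
with distortion at most [ratio]. *)
Definition encodes (W : nat -> bool) (F : opspace R) (g : {linear 'rV[R[i]]_n -> F})
    (A : 'M[R[i]]_n) : Prop :=
  exists2 f : {linear 'rV[R[i]]_n -> F}, (forall k, f (delta_mx 0 k) = g (row k A)) &
    forall m (z : 'M['rV[R[i]]_n]_m),
      (mxnorm (map_mx f z) <= mxnorm (map_mx (os_blocks_map R n W) z))%E /\
      (mxnorm (map_mx (os_blocks_map R n W) z) <= ratio%:E * mxnorm (map_mx f z))%E.

(** If N were in W and not in W', the same test matrix would have norm at least 3 in
one space and at most [gap_norm] in the other. *)
Lemma encodes_sub W W' (F : opspace R) (g : {linear 'rV[R[i]]_n -> F}) A A' (e : R) :
  0 <= e -> n%:R * e <= tol ->
  (forall k h, rnorm (val (g (row k A)) h - val (g (row k A')) h) <= e * rnorm h) ->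
  encodes W g A -> encodes W' g A' -> forall N, W N -> W' N.
Proof.
move=> e0 ne AA' [f fA fW] [f' fA' fW'] N WN; apply/negPn/negP => W'N.
have ff' : forall k h, rnorm (val (f (delta_mx 0 k)) h - val (f' (delta_mx 0 k)) h) <=
    e * rnorm h by move=> k h; rewrite fA fA'.
have A1 := mxnorm_test_ge R n2 WN.
have A2 := (fW _ (test R n N)).2.
have A3 := mxnorm_monomial_perturb (@sqmod_test_coef R n N) (@test_move_inj n N) e0 ff'.
have A4 := (fW' _ (test R n N)).1.
have A5 := mxnorm_test_le R n2 W'N.
have : (3%:E <= ratio%:E * (gap_norm%:E + tol%:E))%E.
  apply: le_trans A1 _; apply: le_trans A2 _.
  rewrite lee_wpmul2l ?lee_fin ?(ltW (lt_trans ltr01 ratio_gt1))//.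
  apply: le_trans A3 _; apply: leeD; last by rewrite lee_fin.
  exact: le_trans A4 A5.
by rewrite -EFinD -EFinM lee_fin leNgt ratio_tol.
Qed.

Definition os_blocks_dim (W : nat -> bool) : opspace_dim R n :=
  @OpSpaceDim R n (os_blocks R n W) (ex_intro _ _ (@os_blocks_map_bij R n W)).

Lemma encodes_near (W : nat -> bool) (F : opspace R) (g : {linear 'rV[R[i]]_n -> F}) :
  bijective g -> (dcb (os_blocks R n W) F < ratio%:E)%E ->
  exists A, encodes W g A.
Proof.
move=> [g' gg' g'g] WF.
have n0 : (0 < n)%N by exact: ltn_trans n2.
have x0 : os_blocks_map R n W (delta_mx 0 (Ordinal n0)) != 0.
  rewrite -(linear0 (os_blocks_map R n W)).
  rewrite (inj_eq (bij_inj (@os_blocks_map_bij R n W))).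
  apply/eqP => /rowP/(_ (Ordinal n0)); rewrite !mxE !eqxx => /eqP.
  by rewrite oner_eq0.
have [w wP] := dcb_lt_normalize x0 WF.
pose f : {linear 'rV[R[i]]_n -> F} := w \o os_blocks_map R n W.
exists (\matrix_k g' (f (delta_mx 0 k))); exists f.
  by move=> k; rewrite rowK g'g.
by move=> m z; rewrite /f map_mx_comp; exact: wP.
Qed.

End rounding.

(** * Non-separability *)

Theorem theorem2p3 (R : realType) (n : nat) (hn : (2 < n)%N) :
  ~ separable_space (OS R n).
Proof.
move=> [D cD /dense_delta_cb dD].
have /countable_injP[num numI] := cD.
pose g (y : OS R n) : {linear 'rV[R[i]]_n -> os_repr y} :=
  projT1 (cid (osd_dim (os_repr y))).
have gP y : bijective (g y) := projT2 (cid (osd_dim (os_repr y))).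
have n0 : 0 < n%:R :> R by rewrite ltr0n (ltn_trans _ hn).
pose e : R := tol R / n%:R.
have e0 : 0 < e by rewrite divr_gt0// (tol_gt0 R).
have /choice[d dP] : forall y, exists d : R, 0 < d /\ forall A A' : 'M[R[i]]_n,
    code d A = code d A' -> forall k h,
    rnorm (val (g y (row k A)) h - val (g y (row k A')) h) <= e * rnorm h.
  by move=> y; have [d d0 dP] := coding_scale (g y) e0; exists d.
have /choice[c cP] : forall W, exists c : OS R n * 'M[R[i]]_n,
    D c.1 /\ encodes W (g c.1) c.2.
  move=> W; have [y Dy] := dD (os_of (os_blocks_dim R n W)) (ln (ratio R)) (ln_gt0 (ratio_gt1 R)).
  rewrite -[in X in X -> _](os_reprK y) delta_cb_of -lte_expeR lneK; last first.
    by rewrite in_itv/= dcb_ge0 leey.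
  rewrite /= lnK ?posrE ?(lt_trans ltr01 (ratio_gt1 R))// => WF.
  by have [A WA] := encodes_near hn (gP y) WF; exists (y, A).
(* The mesh d depends on the member of D, which the first component determines. *)
pose f (W : nat -> bool) := (num (c W).1, code (d (c W).1) (c W).2).
apply: (@cantor_bool _ f) => W W' [].
have [DW] := cP W; have [DW'] := cP W'.
case: (c W) (c W') DW DW' => [y A] [y' A'] /= Dy Dy' W'A' WA.
move=> /(numI _ _ (mem_set Dy) (mem_set Dy')) yy'; subst y' => AA'.
have ne : n%:R * e <= tol R by rewrite /e mulrCA mulfV ?mulr1// gt_eqF.
have [_ dy] := dP y.
apply/funext => N; apply/idP/idP.
  exact: (@encodes_sub R n hn W W' _ (g y) A A' e (ltW e0) ne (dy _ _ AA') WA W'A').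
exact: (@encodes_sub R n hn W' W _ (g y) A' A e (ltW e0) ne (dy _ _ (esym AA')) W'A' WA).
Qed.
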